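(* Let $R$ be a rank on a class of complete types. (1) If $R$ is a Lascar-splitting rank, then $R$ has Strong bounded multiplicity. (2) If $R$ has Bounded multiplicity and Extension, then $R$ is a Lascar-splitting rank.
   Context: $T$ is a complete first-order theory in a language $L$ with a monster model $\mathfrak C$ that is $\bar\kappa$-saturated and strongly $\bar\kappa$-homogeneous for a sufficiently large cardinal $\bar\kappa$ (e.g. strongly inaccessible). All parameter sets are small subsets of $\mathfrak C$ (cardinality $<\bar\kappa$), and cardinals quantified over in the definitions below are small. Complete types are finitary. A global type is a complete type over $\mathfrak C$. A class of complete types is a class $\mathfrak A$ of complete types closed under complete extensions and under conjugation by automorphisms of $\mathfrak C$. A rank on $\mathfrak A$ is a mapping $R:\mathfrak A\to\mathrm{Ord}\cup\{\infty\}$ with Heredity ($p\subseteq q$ implies $R(p)\ge R(q)$) and Isomorphism ($R(p)=R(p^f)$ for $f\in Aut(\mathfrak C)$); $p$ is ranked if $R(p)<\infty$. Lascar-splitting: $Autf(\mathfrak C/A)$ is the subgroup of $Aut(\mathfrak C/A)$ generated by the automorphisms fixing pointwise some model containing $A$; $a\stackrel{Ls}{\equiv}_A b$ means $a,b$ are in the same orbit under $Autf(\mathfrak C/A)$. A complete type $p(x)$ over $B\supseteq A$ (possibly $B=\mathfrak C$) Lascar-splits over $A$ if for some $\varphi(x,y)\in L$ there are tuples $a,b\in B$ with $a\stackrel{Ls}{\equiv}_A b$, $\varphi(x,a)\in p$, $\neg\varphi(x,b)\in p$. $R$ is a Lascar-splitting rank if for all $p\in S(A)$, $q\in S(B)$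 in $\mathfrak A$ with $p\subseteq q$, $p$ ranked, and every global extension of $q$ Lascar-splitting over $A$, one has $R(p)>R(q)$. $R$ has Bounded multiplicity if for each ranked $p\in\mathfrak A$, $p\in S(A)$, there is a cardinal $\kappa$ such that for any $B\supseteq A$, $p$ has at most $\kappa$ different extensions $q\in S(B)$ with $R(q)=R(p)$. $R$ has Strong bounded multiplicity if for each ranked $p\in\mathfrak A$ and each $k\ge 2$ there is a cardinal $\kappa$ such that any $k$-inconsistent collection of complete types extending $p$, all with the same rank as $p$, has cardinality at most $\kappa$ ($k$-inconsistent: the union of any $k$ distinct members is inconsistent). $R$ has Extension if for every ranked $p\in S(A)$ in $\mathfrak A$ and every $B\supseteq A$ there is an extension $q\in S(B)$ of $p$ with $R(p)=R(q)$. *)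

(* Defs.v *)
From mathcomp Require Import all_boot.
From mathcomp Require Import boolp classical_sets functions cardinality.

Set Implicit Arguments.
Unset Strict Implicit.
Unset Printing Implicit Defensive.

Local Open Scope classical_set_scope.
Local Open Scope card_scope.

(** * First-order logic *)

Record language := Language {
  func : Type;
  func_arity : func -> nat;
  rel_symb : Type;
  rel_arity : rel_symb -> nat }.

(* [formula L V]: formulas with free variables in [V]. A quantifier adds one
   variable, [None], to the free variables of its scope, so syntactic equality
   is equality up to renaming of bound variables. *)
Inductive term (L : language) (V : Type) : Type :=
| tvar of V
| tapp (f : func L) of ('I_(func_arity f) -> term L V).

Inductive formula (L : language) (V : Type) : Type :=
| fbot
| feq of term L V & term L V
| fatom (r : rel_symb L) of ('I_(rel_arity r) -> term L V)
| fimp of formula L V & formula L V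
| fall of formula L (option V).

Arguments fbot {L V}.

Definition fneg L V (phi : formula L V) : formula L V := fimp phi fbot.

Fixpoint term_rename L V W (h : V -> W) (t : term L V) : term L W :=
  match t with
  | tvar v => tvar L (h v)
  | tapp f u => tapp (fun i => term_rename h (u i))
  end.

Fixpoint rename L V W (h : V -> W) (phi : formula L V) : formula L W :=
  match phi with
  | fbot => fbot
  | feq t u => feq (term_rename h t) (term_rename h u)
  | fatom r u => fatom (fun i => term_rename h (u i))
  | fimp psi chi => fimp (rename h psi) (rename h chi)
  | fall psi => fall (rename (omap h) psi)
  end.

Record structure (L : language) := Structure {
  carrier :> Type;
  carrier_inhabited : inhabited carrier;
  interp_func : forall f : func L, ('I_(func_arity f) -> carrier) -> carrier;
  interp_rel : forall r : rel_symb L, ('I_(rel_arity r) -> carrier) -> Prop }.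

Fixpoint eval L (M : structure L) V (e : V -> M) (t : term L V) : M :=
  match t with
  | tvar v => e v
  | tapp f u => interp_func (fun i => eval e (u i))
  end.

Fixpoint sat L (M : structure L) V (e : V -> M) (phi : formula L V) : Prop :=
  match phi with
  | fbot => False
  | feq t u => eval e t = eval e u
  | fatom r u => interp_rel (fun i => eval e (u i))
  | fimp psi chi => sat e psi -> sat e chi
  | fall psi => forall x : M, sat (fun o => oapp e x o) psi
  end.

Definition sentence (L : language) := formula L void.

Definition holds_in L (M : structure L) (s : sentence L) : Prop :=
  sat (fun v : void => match v return M with end) s.

Definition models L (M : structure L) (T : set (sentence L)) : Prop :=
  forall s, T s -> holds_in M s.

Definition entails L (T : set (sentence L)) (s : sentence L) : Prop :=
  forall M : structure L, models M T -> holds_in M s.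

Definition complete_theory L (T : set (sentence L)) : Prop :=
  (exists M : structure L, models M T) /\
  forall s, entails T s \/ entails T (fneg s).

Definition elementary_embedding L (M N : structure L) (j : M -> N) : Prop :=
  forall m (phi : formula L 'I_m) (a : 'I_m -> M),
    sat a phi <-> sat (j \o a) phi.

Definition automorphism L (C : structure L) (f : C -> C) : Prop :=
  [/\ bijective f,
      forall (g : func L) (a : 'I_(func_arity g) -> C),
        f (interp_func a) = interp_func (f \o a)
    & forall (r : rel_symb L) (a : 'I_(rel_arity r) -> C),
        interp_rel a <-> interp_rel (f \o a)].

(** * Cardinals *)

Definition card_lt T U (A : set T) (B : set U) : Prop :=
  A #<= B /\ ~ (B #<= A).

(* The cardinal kappa-bar is the cardinal of a type [K]. *)
Definition small (K T : Type) (A : set T) : Prop := card_lt A [set: K].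

(* The cardinal of [K] is uncountable, strong limit and larger than the number
   of symbols of [L]; this includes every strongly inaccessible cardinal larger
   than the number of symbols of [L]. *)
Definition sufficiently_large (L : language) (K : Type) : Prop :=
  [/\ ~ countable [set: K],
      forall A : set K, small K A -> small K [set X : set K | X `<=` A],
      small K [set: func L]
    & small K [set: rel_symb L]].

(** * Complete types *)

(* Formulas in the variables ['I_n] with parameters from [C]. *)
Definition pformula L (C : structure L) (n : nat) := formula L ('I_n + C).

(* [inst a phi(x,y)] is [phi(x,a)]. *)
Definition inst L V P Q (a : P -> Q) (phi : formula L (V + P)) :
    formula L (V + Q) :=
  rename (fun s => match s with inl v => inl v | inr y => inr (a y) end) phi.

(* The formulas of L(A). *)
Definition formula_over L (C : structure L) n (A : set C) (phi : pformula C n) :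
    Prop :=
  exists m (psi : formula L ('I_n + 'I_m)) (a : 'I_m -> C),
    (forall j, A (a j)) /\ phi = inst a psi.

Definition psat L (C : structure L) n (e : 'I_n -> C) (phi : pformula C n) :
    Prop :=
  sat (fun s => match s with inl i => e i | inr c => c end) phi.

Definition consistent L (C : structure L) n (p : set (pformula C n)) : Prop :=
  forall s : set (pformula C n), finite_set s -> s `<=` p ->
    exists e : 'I_n -> C, forall phi, s phi -> psat e phi.

(* [complete_type A p] is p \in S_n(A). A complete type determines its domain,
   since the formula c = c belongs to p exactly when c \in A. *)
Definition complete_type L (C : structure L) n (A : set C)
    (p : set (pformula C n)) : Prop :=
  [/\ p `<=` formula_over A,
      consistent p
    & forall phi, formula_over A phi -> p phi \/ p (fneg phi)].

Definition global_type L (C : structure L) n (p : set (pformula C n)) : Prop :=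
  complete_type setT p.

Definition conj_type L (C : structure L) n (f : C -> C)
    (p : set (pformula C n)) : set (pformula C n) :=
  [set inst f phi | phi in p].

(** * Monster model *)

Definition saturated L (C : structure L) (K : Type) : Prop :=
  forall (A : set C) (p : set (pformula C 1)), small K A -> complete_type A p ->
    exists e : 'I_1 -> C, forall phi, p phi -> psat e phi.

Definition strongly_homogeneous L (C : structure L) (K : Type) : Prop :=
  forall (A : set C) (f : C -> C), small K A ->
    (forall m (phi : formula L 'I_m) (a : 'I_m -> C), (forall j, A (a j)) ->
       (sat a phi <-> sat (f \o a) phi)) ->
    exists g : C -> C, automorphism g /\ forall c, A c -> g c = f c.

Definition monster_model L (T : set (sentence L)) (K : Type)
    (C : structure L) : Prop :=
  [/\ models C T, saturated C K & strongly_homogeneous C K].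

(** * Lascar-splitting *)

Definition small_model L (C : structure L) (K : Type) (M : set C) : Prop :=
  small K M /\
  exists (N : structure L) (j : N -> C), elementary_embedding j /\ M = range j.

Inductive Autf L (C : structure L) (K : Type) (A : set C) : (C -> C) -> Prop :=
| Autf_model (M : set C) (f : C -> C) :
    small_model K M -> A `<=` M ->
    automorphism f -> (forall c, M c -> f c = c) -> Autf K A f
| Autf_id : Autf K A id
| Autf_comp (f g : C -> C) : Autf K A f -> Autf K A g -> Autf K A (f \o g)
| Autf_inv (f g : C -> C) :
    Autf K A f -> cancel f g -> cancel g f -> Autf K A g.

Definition Lascar_equiv L (C : structure L) (K : Type) (A : set C) m
    (a b : 'I_m -> C) : Prop :=
  exists f : C -> C, Autf K A f /\ forall i, f (a i) = b i.

(* [p] is a complete type over [B], and A `<=` B. *)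
Definition Lascar_splits L (C : structure L) (K : Type) n (A B : set C)
    (p : set (pformula C n)) : Prop :=
  exists m (phi : formula L ('I_n + 'I_m)) (a b : 'I_m -> C),
    [/\ (forall i, B (a i)) /\ (forall i, B (b i)),
        Lascar_equiv K A a b,
        p (inst a phi)
      & p (fneg (inst b phi))].

(** * Ranks *)

Definition type_class L (C : structure L) (K : Type)
    (cls : forall n, set (set (pformula C n))) : Prop :=
  [/\ forall n p, cls n p -> exists2 A : set C, small K A & complete_type A p,
      forall n p (B : set C) q, cls n p -> small K B -> complete_type B q ->
        p `<=` q -> cls n q
    & forall n p f, cls n p -> automorphism f -> cls n (conj_type f p)].

Definition well_order (W : Type) (lt : W -> W -> Prop) : Prop :=
  [/\ well_founded lt,
      forall x y z, lt x y -> lt y z -> lt x z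
    & forall x y, [\/ lt x y, x = y | lt y x]].

(* Ranks take values in [option W], for an arbitrary well-ordered [W] standing
   for (an initial segment of) the ordinals; [None] is the value infinity. *)
Definition rank_lt W (lt : W -> W -> Prop) (x y : option W) : Prop :=
  match x, y with
  | Some a, Some b => lt a b
  | Some _, None => True
  | None, _ => False
  end.

Definition rank_le W (lt : W -> W -> Prop) (x y : option W) : Prop :=
  x = y \/ rank_lt lt x y.

(* [R] is only meaningful on [cls]. *)
Definition is_rank L (C : structure L) W (lt : W -> W -> Prop)
    (cls : forall n, set (set (pformula C n)))
    (R : forall n, set (pformula C n) -> option W) : Prop :=
  (forall n p q, cls n p -> cls n q -> p `<=` q -> rank_le lt (R n q) (R n p))
  /\
  (forall n p f, cls n p -> automorphism f -> R n p = R n (conj_type f p)).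

Definition ranked L (C : structure L) W
    (R : forall n, set (pformula C n) -> option W) n (p : set (pformula C n)) :
    Prop :=
  R n p <> None.

Definition Lascar_splitting_rank L (C : structure L) (K : Type) W
    (lt : W -> W -> Prop) (cls : forall n, set (set (pformula C n)))
    (R : forall n, set (pformula C n) -> option W) : Prop :=
  forall n (A B : set C) (p q : set (pformula C n)),
    small K A -> small K B -> complete_type A p -> complete_type B q ->
    cls n p -> cls n q -> p `<=` q -> ranked R p ->
    (forall g, global_type g -> q `<=` g -> Lascar_splits K A setT g) ->
    rank_lt lt (R n q) (R n p).

(* Small cardinals are represented by the small subsets of [K]. *)
Definition bounded_multiplicity L (C : structure L) (K : Type) W
    (cls : forall n, set (set (pformula C n)))
    (R : forall n, set (pformula C n) -> option W) : Prop :=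
  forall n (A : set C) (p : set (pformula C n)),
    small K A -> complete_type A p -> cls n p -> ranked R p ->
    exists kappa : set K, small K kappa /\
      forall B : set C, small K B -> A `<=` B ->
        [set q | [/\ complete_type B q, p `<=` q & R n q = R n p]] #<= kappa.

Definition k_inconsistent L (C : structure L) n (k : nat)
    (F : set (set (pformula C n))) : Prop :=
  forall q : 'I_k -> set (pformula C n), injective q -> (forall i, F (q i)) ->
    ~ consistent (\bigcup_i q i).

Definition strong_bounded_multiplicity L (C : structure L) (K : Type) W
    (cls : forall n, set (set (pformula C n)))
    (R : forall n, set (pformula C n) -> option W) : Prop :=
  forall n (p : set (pformula C n)) (k : nat),
    cls n p -> ranked R p -> (2 <= k)%N ->
    exists kappa : set K, small K kappa /\
      forall F : set (set (pformula C n)),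
        (forall q, F q ->
           [/\ exists2 B : set C, small K B & complete_type B q,
               p `<=` q & R n q = R n p]) ->
        k_inconsistent k F -> F #<= kappa.

Definition has_extension L (C : structure L) (K : Type) W
    (cls : forall n, set (set (pformula C n)))
    (R : forall n, set (pformula C n) -> option W) : Prop :=
  forall n (A B : set C) (p : set (pformula C n)),
    small K A -> complete_type A p -> cls n p -> ranked R p ->
    small K B -> A `<=` B ->
    exists q, [/\ complete_type B q, p `<=` q & R n q = R n p].

(* Main.v *)
Require Import Defs.
From mathcomp Require Import all_boot.
From mathcomp Require Import boolp classical_sets functions cardinality filter.

(** (1) Let [p] be over [A], and let [M] be a small model containing [A]. Every
    [q] extending [p] with the same rank has a global extension which does not
    Lascar-split over [A]. Tuples with the same type over [M] are
    Lascar-equivalent over [A], so such a global type [g] is determined by the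
    pairs [(phi, tp(b/M))] with [phi(x,b)] in [g], hence there is a small number
    of them. Fewer than [k] members of a [k]-inconsistent family can share the
    same [g].

    (2) Call [a] and [b] indistinguishable (for [phi]) if every extension of [p]
    of the same rank over a set containing [a, b] contains [phi(x,a)] iff it
    contains [phi(x,b)]. By Extension this does not depend on the set, so it is an
    [A]-invariant equivalence relation; by Bounded multiplicity it has a small
    number of classes. A coheir argument shows that it identifies tuples of the
    same type over a model containing [A], and so it is coarser than Lascar
    equivalence. If [q] extends [p] with [R q = R p], Extension now shows that [q]
    is consistent with all the formulas [phi(x,a) -> phi(x,b)] for
    Lascar-equivalent [a, b], and a global completion of [q] and these formulas
    does not Lascar-split over [A]. *)

Set Implicit Arguments.
Unset Strict Implicit.
Unset Printing Implicit Defensive.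

Local Open Scope classical_set_scope.
Local Open Scope card_scope.

(** * Small cardinals *)

Definition embeds (T U : Type) : Prop := exists f : T -> U, injective f.

Lemma embeds_trans T U V : embeds T U -> embeds U V -> embeds T V.
Proof. by move=> [f fI] [g gI]; exists (g \o f); apply: inj_comp. Qed.

Lemma card_le_embeds T U (A : set T) (B : set U) : A #<= B <-> embeds A B.
Proof.
split=> [/card_leP[f]|[f fI]].
  by exists f => x y; apply: inj; rewrite inE.
rewrite -(card_le_eql (card_setT A)) -(card_le_eqr (card_setT B)).
have fI' : {in [set: A] &, injective f} by move=> x y _ _; apply: fI.
by rewrite -(card_le_eql (inj_card_eq fI')) card_leT.
Qed.

Lemma card_le_type T U : [set: T] #<= [set: U] <-> embeds T U.
Proof.
split=> [/card_le_embeds[f fI]|[f fI]]; last first.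
  have fI' : {in [set: T] &, injective f} by move=> x y _ _; apply: fI.
  by rewrite -(card_le_eql (inj_card_eq fI')) card_leT.
exists (fun x => val (f (SigSub (mem_set (I : [set: T] x))))).
by move=> x y /val_inj/fI [].
Qed.

Definition smallt (K T : Type) : Prop := embeds T K /\ ~ embeds K T.

Lemma small_smallt K T (A : set T) : small K A <-> smallt K A.
Proof.
rewrite /small /card_lt /smallt.
rewrite -(card_le_eql (card_setT A)) -(card_le_eqr (card_setT A)).
by rewrite !card_le_type.
Qed.

Lemma small_setT K T : small K [set: T] <-> smallt K T.
Proof. by rewrite /small /card_lt !card_le_type. Qed.

Lemma smallt_embeds K T U : embeds T U -> smallt K U -> smallt K T.
Proof.
move=> TU [UK KU]; split; first exact: embeds_trans UK.
by move=> KT; apply: KU; apply: embeds_trans TU.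
Qed.

(** Zorn's lemma on graphs of partial injections: a maximal graph is total on one side, since
    otherwise a pair of unmatched points could be added. *)
Lemma embeds_total T U : embeds T U \/ embeds U T.
Proof.
pose P (G : set (T * U)) :=
  forall x y, G x -> G y -> (x.1 = y.1 <-> x.2 = y.2).
have [F FP totF|G [PG maxG]] := @Zorn_bigcup (T * U)%type P.
  move=> x y [X FX Xx] [Y FY Yy].
  by case: (totF X Y FX FY) => XY; [apply: (FP Y) => //; apply: XY|
    apply: (FP X) => //; apply: XY].
case: (pselect (forall t, exists u, G (t, u))) => [dom|].
  left; have [f Gf] := choice dom; exists f => x y fxy.
  by apply/(PG _ _ (Gf x) (Gf y)).
move=> /existsNP[t nt].
case: (pselect (forall u, exists t, G (t, u))) => [dom|].
  right; have [f Gf] := choice dom; exists f => x y fxy.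
  by apply/(PG _ _ (Gf x) (Gf y)).
move=> /existsNP[u nu]; exfalso.
apply: (maxG (G `|` [set (t, u)])).
  split; first by move=> x Gx; left.
  by move=> h; apply: nt; exists u; apply: h; right.
move=> [x1 x2] [y1 y2] [Gx|[-> ->]] [Gy|[-> ->]] //=.
- exact: PG Gx Gy.
- by split=> e; [case: nt; exists x2|case: nu; exists x1]; rewrite -e.
- by split=> e; [case: nt; exists y2|case: nu; exists y1]; rewrite e.
Qed.

(** * Closure of smallness under cardinal arithmetic *)

Section Large.
Variable L : language.
Variable K : Type.
Hypothesis K_large : sufficiently_large L K.

Lemma smallt_countable T : embeds T nat -> smallt K T.
Proof.
case: K_large => Kunc _ _ _ Tn.
apply: smallt_embeds Tn _.
have nKn : ~ embeds K nat by move=> h; apply: Kunc; rewrite /countable card_le_type.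
by split=> //; case: (embeds_total K nat).
Qed.

Lemma smallt_count (T : countType) : smallt K T.
Proof.
by apply: smallt_countable; exists choice.pickle; apply: pcan_inj (@pickleK _).
Qed.

Lemma small_le T U (A : set T) (B : set U) : A #<= B -> small K B -> small K A.
Proof.
move=> AB [BK KB]; split; first exact: card_le_trans BK.
by move=> KA; apply: KB; apply: card_le_trans AB.
Qed.

Lemma small_sub T (A B : set T) : A `<=` B -> small K B -> small K A.
Proof. by move=> /subset_card_le; apply: small_le. Qed.

Lemma small_image T U (f : T -> U) (A : set T) : small K A -> small K (f @` A).
Proof. exact/small_le/card_image_le. Qed.

Lemma small_range T U (f : T -> U) : smallt K T -> small K (range f).
Proof. by move=> /small_setT; apply: small_image. Qed.

(** The strong limit hypothesis speaks of subsets of [K], so a subset of [T] is replaced by its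
    image under an embedding into [K]. *)
Lemma smallt_power T : smallt K T -> smallt K (set T).
Proof.
move=> sT; case: K_large => _ pK _ _.
have [[f fI] _] := sT.
have /pK/small_smallt := small_range f sT.
apply: smallt_embeds.
have sub (X : set T) : [set Y : set K | Y `<=` range f] (f @` X).
  by move=> _ [x _ <-]; exists x.
exists (fun X => SigSub (mem_set (sub X)) : [set Y : set K | Y `<=` range f]).
move=> X Y [] /seteqP[XY YX]; apply/seteqP; split=> x xX.
  by have [|y ? /fI <-] := XY (f x); first by exists x.
by have [|y ? /fI <-] := YX (f x); first by exists x.
Qed.

(** Pairs embed in the double power set, so closure under powers is enough and the squares of
    infinite cardinals need not be computed. *)
Lemma smallt_square T : smallt K T -> smallt K (T * T).
Proof.
move=> /smallt_power/smallt_power; apply: smallt_embeds.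
(* Kuratowski pairs *)
exists (fun x => [set [set x.1]; [set x.1; x.2]]) => -[a b] [c d] /= e.
have s1 (x y z : T) : [set x] = [set y; z] -> x = y /\ x = z.
  by move=> /seteqP[_ h]; split; apply/esym/h; [left|right].
have ac : a = c.
  have [] : [set [set c]; [set c; d]] [set a] by rewrite -e; left.
    by move=> /seteqP[h _]; apply: h.
  by move=> /s1[].
subst c; congr pair.
have [/esym/s1[_ ab]|] : [set [set a]; [set a; d]] [set a; b].
- by rewrite -e; right.
- subst b.
  have [/esym/s1[_ ->] //|/seteqP[h _]] : [set [set a]; [set a; a]] [set a; d].
    by rewrite e; right.
  by have [<-|<-] : [set a; a] d by apply: h; right.
- move=> /seteqP[h1 h2].
  have [ba|//] : [set a; d] b by apply: h1; right.
  have [da|//] : [set a; b] d by apply: h2; right.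
  by rewrite ba da.
Qed.

Lemma smallt_prod T U : smallt K T -> smallt K U -> smallt K (T * U).
Proof.
move=> sT sU; case: (embeds_total T U) => -[f fI].
  apply: smallt_embeds (smallt_square sU).
  by exists (fun x => (f x.1, x.2)) => -[? ?] [? ?] [/fI -> ->].
apply: smallt_embeds (smallt_square sT).
by exists (fun x => (x.1, f x.2)) => -[? ?] [? ?] [-> /fI ->].
Qed.

Lemma smallt_sum T U : smallt K T -> smallt K U -> smallt K (T + U).
Proof.
move=> sT sU; case: (embeds_total T U) => -[f fI].
  apply: smallt_embeds (smallt_prod sU (smallt_count bool)).
  exists (fun x => match x with inl t => (f t, true) | inr u => (u, false) end).
  by move=> [?|?] [?|?] [] // => [/fI ->|->].
apply: smallt_embeds (smallt_prod sT (smallt_count bool)).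
exists (fun x => match x with inl t => (t, true) | inr u => (f u, false) end).
by move=> [?|?] [?|?] [] // => [->|/fI ->].
Qed.

Lemma smallt_fun T U : smallt K T -> smallt K U -> smallt K (T -> U).
Proof.
move=> sT sU; apply: smallt_embeds (smallt_power (smallt_prod sT sU)).
exists (fun f => [set x | f x.1 = x.2]) => f g /seteqP[fg _].
by apply/funext => x; rewrite (fg (x, f x)).
Qed.

Lemma smallt_option T : smallt K T -> smallt K (option T).
Proof.
move=> sT; apply: smallt_embeds (smallt_sum sT (smallt_count unit)).
exists (fun o => if o is Some x then inl x else inr tt).
by move=> [?|] [?|] // [->].
Qed.

Lemma small_setU T (A B : set T) : small K A -> small K B -> small K (A `|` B).
Proof.
move=> /small_smallt sA /small_smallt sB.
apply: small_sub (small_range (fun x : A + B =>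
  match x with inl a => val a | inr b => val b end) (smallt_sum sA sB)).
move=> x [xA|xB]; first by exists (inl (SigSub (mem_set xA))).
by exists (inr (SigSub (mem_set xB))).
Qed.

Lemma small_tuple m T (a : 'I_m -> T) : small K (range a).
Proof. exact/small_range/smallt_count. Qed.

(** Each fibre is numbered injectively by naturals, and an element is recovered from its fibre and
    its number. No uniform bound on the fibres is involved. *)
Lemma finite_fibres_embeds T U (F : set T) (G : T -> U) :
  (forall u, finite_set [set t | F t /\ G t = u]) -> embeds F (U * nat).
Proof.
move=> fin.
have /choice[h hI] u : exists h : T -> nat,
    {in [set t | F t /\ G t = u] &, injective h}.
  by have /countable_injP[h ?] := finite_set_countable (fin u); exists h.
exists (fun t => (G (val t), h (G (val t)) (val t))) => x y [Gxy].
rewrite Gxy => /hI hxy; apply/val_inj/hxy; rewrite inE /=; split=> //;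
  exact/set_mem/valP.
Qed.

End Large.

(** * Syntax *)

Definition copair X Y Z (f : X -> Z) (g : Y -> Z) (s : X + Y) : Z :=
  match s with inl x => f x | inr y => g y end.

Definition of_ord0 X (i : 'I_0) : X := False_rect X (notF (valP i)).

Section Syntax.
Variable L : language.

Lemma term_rename_comp V W X (h : V -> W) (g : W -> X) (t : term L V) :
  term_rename g (term_rename h t) = term_rename (g \o h) t.
Proof. by elim: t => //= f u IH; congr tapp; apply/funext. Qed.

Lemma rename_comp V W X (h : V -> W) (g : W -> X) (phi : formula L V) :
  rename g (rename h phi) = rename (g \o h) phi.
Proof.
elim: phi W X h g => {V} [V|V t u|V r u|V psi IH1 chi IH2|V psi IH] W X h g //=.
- by rewrite !term_rename_comp.
- by congr fatom; apply/funext => i; rewrite term_rename_comp.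
- by rewrite IH1 IH2.
- by rewrite IH; congr (fall (rename _ _)); apply/funext; case.
Qed.

Lemma rename_id V (phi : formula L V) : rename id phi = phi.
Proof.
have tE W (t : term L W) : term_rename id t = t.
  by elim: t => //= f u IH; congr tapp; apply/funext.
elim: phi => {V} [V|V t u|V r u|V psi IH1 chi IH2|V psi IH] //=.
- by rewrite !tE.
- by congr fatom; apply/funext => i; rewrite tE.
- by rewrite IH1 IH2.
- by rewrite -[in RHS]IH; congr (fall (rename _ _)); apply/funext; case.
Qed.

Lemma eval_rename (M : structure L) V W (h : V -> W) (e : W -> M) (t : term L V) :
  eval e (term_rename h t) = eval (e \o h) t.
Proof. by elim: t => //= f u IH; congr interp_func; apply/funext. Qed.

Lemma sat_rename (M : structure L) V W (h : V -> W) (e : W -> M)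
    (phi : formula L V) :
  sat e (rename h phi) = sat (e \o h) phi.
Proof.
elim: phi W h e => {V} [V|V t u|V r u|V psi IH1 chi IH2|V psi IH] W h e //=.
- by rewrite !eval_rename.
- by congr interp_rel; apply/funext => i; rewrite eval_rename.
- by rewrite IH1 IH2.
- apply: eq_forall => x; rewrite IH; congr sat; apply/funext; by case.
Qed.

Definition fexists V (phi : formula L (option V)) : formula L V :=
  fneg (fall (fneg phi)).

Definition fand V (phi psi : formula L V) : formula L V :=
  fneg (fimp phi (fneg psi)).

Lemma sat_fexists (M : structure L) V (e : V -> M) (phi : formula L (option V)) :
  sat e (fexists phi) <-> exists x, sat (fun o => oapp e x o) phi.
Proof.
split=> [/= h|[x hx] /= /(_ x)]; last by apply.
by apply: contra_notP h => h x hx; apply: h; exists x.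
Qed.

Lemma sat_fand (M : structure L) V (e : V -> M) (phi psi : formula L V) :
  sat e (fand phi psi) <-> sat e phi /\ sat e psi.
Proof.
split=> [/= h|[h1 h2] /=]; last by apply.
by split; apply: contra_notP h => h h1 h2.
Qed.

(** Induction on [m]: [h] turns [ord0] into the variable to be bound and lowers the others. One
    [psi] serves all structures, so it can be moved along elementary embeddings. *)
Lemma fexists_tuple m V (phi : formula L ('I_m + V)) :
  exists psi : formula L V, forall (M : structure L) (e : V -> M),
    sat e psi <-> exists x : 'I_m -> M, sat (copair x e) phi.
Proof.
elim: m V phi => [|m IH] V phi.
  exists (rename (copair (of_ord0 V) id) phi) => M e; rewrite sat_rename.
  have E (x : 'I_0 -> M) : copair x e = e \o copair (of_ord0 V) id.
    by apply/funext => -[[]|].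
  by split=> [h|[x]]; [exists (of_ord0 M)|]; rewrite E.
pose h (s : 'I_m.+1 + V) : option ('I_m + V) :=
  match s with inl i => omap inl (unlift ord0 i) | inr v => Some (inr v) end.
have [psi psiE] := IH V (fexists (rename h phi)).
exists psi => M e; rewrite psiE; split=> [[x /sat_fexists[y]]|[x hx]].
  rewrite sat_rename => hy; exists (fun i => oapp x y (unlift ord0 i)).
  congr sat: hy; apply/funext => -[i|v] //=.
  by case: (unlift _ _).
exists (x \o lift ord0); apply/sat_fexists; exists (x ord0).
rewrite sat_rename; congr sat: hx; apply/funext => -[i|v] //=.
by case: unliftP => [j ->|->].
Qed.

(** Parameters are indexed by a finite type: at an application, the index types of the arguments are
    collected in a dependent sum. *)
Lemma term_support V X Y (h : V -> X + Y) (t : term L V) :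
  exists (W : finType) (s : term L (X + W)) (a : W -> Y),
    term_rename h t = term_rename (copair inl (inr \o a)) s.
Proof.
elim: t => [v|f u IH] /=.
  case: (h v) => [x|y].
    by exists void, (tvar L (inl x)), (of_void _).
  by exists unit, (tvar L (inr tt)), (fun=> y).
have /choice[F FP] i : exists F : {W : finType & (term L (X + W) * (W -> Y))%type},
    term_rename h (u i) = term_rename (copair inl (inr \o (projT2 F).2)) (projT2 F).1.
  by have [W [s [a E]]] := IH i; exists (existT _ W (s, a)).
exists {i : 'I_(func_arity f) & projT1 (F i)},
  (tapp (fun i => term_rename (copair inl (fun w =>
     inr (existT (fun i => projT1 (F i)) i w))) (projT2 (F i)).1)),
  (fun w => (projT2 (F (projT1 w))).2 (projT2 w)).
rewrite /=; congr tapp; apply/funext => i; rewrite FP term_rename_comp.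
by congr term_rename; apply/funext; case.
Qed.

(** The renaming [h] is part of the statement so that the induction passes under quantifiers, where
    the type of variables changes. *)
Lemma formula_support_fin V X Y (h : V -> X + Y) (phi : formula L V) :
  exists (W : finType) (psi : formula L (X + W)) (a : W -> Y),
    rename h phi = inst a psi.
Proof.
rewrite /inst.
elim: phi X Y h => {V} [V|V t u|V r u|V psi IH1 chi IH2|V psi IH] X Y h /=.
- by exists void, fbot, (of_void _).
- have [W1 [s1 [a1 ->]]] := term_support h t.
  have [W2 [s2 [a2 ->]]] := term_support h u.
  exists (W1 + W2)%type, (feq
    (term_rename (copair inl (inr \o inl)) s1)
    (term_rename (copair inl (inr \o inr)) s2)), (copair a1 a2).
  by rewrite /= !term_rename_comp; congr feq; congr term_rename;
    apply/funext => -[].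
- have /choice[F FP] i : exists F : {W : finType & (term L (X + W) * (W -> Y))%type},
    term_rename h (u i) = term_rename (copair inl (inr \o (projT2 F).2)) (projT2 F).1.
    by have [W [s [a E]]] := term_support h (u i); exists (existT _ W (s, a)).
  exists {i : 'I_(rel_arity r) & projT1 (F i)},
    (fatom (fun i => term_rename (copair inl (fun w =>
       inr (existT (fun i => projT1 (F i)) i w))) (projT2 (F i)).1)),
    (fun w => (projT2 (F (projT1 w))).2 (projT2 w)).
  rewrite /=; congr fatom; apply/funext => i; rewrite FP term_rename_comp.
  by congr term_rename; apply/funext; case.
- have [W1 [s1 [a1 ->]]] := IH1 _ _ h.
  have [W2 [s2 [a2 ->]]] := IH2 _ _ h.
  exists (W1 + W2)%type, (fimp
    (rename (copair inl (inr \o inl)) s1)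
    (rename (copair inl (inr \o inr)) s2)), (copair a1 a2).
  by rewrite /= !rename_comp; congr fimp; congr rename; apply/funext => -[].
(* The bound variable joins the [X] side, so that only elements of [Y] are collected as
   parameters. *)
- pose g (s : option (X + Y)) : option X + Y :=
    match s with
    | None => inl None | Some (inl x) => inl (Some x) | Some (inr y) => inr y
    end.
  have [W [s [a E]]] := IH _ _ (g \o omap h).
  exists W, (fall (rename (copair (omap inl) (Some \o inr)) s)), a.
  rewrite /=; congr fall.
  have gK : omap h = copair (omap inl) (Some \o inr) \o (g \o omap h).
    by apply/funext => -[v|] //=; case: (h v).
  rewrite gK -rename_comp E !rename_comp; congr rename.
  by apply/funext => -[[]|].
Qed.

Lemma formula_support V X Y (h : V -> X + Y) (phi : formula L V) :
  exists m (psi : formula L (X + 'I_m)) (a : 'I_m -> Y),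
    rename h phi = inst a psi.
Proof.
have [W [psi [a ->]]] := formula_support_fin h phi.
exists #|W|, (rename (copair inl (inr \o enum_rank)) psi), (a \o enum_val).
rewrite /inst rename_comp; congr rename.
by apply/funext => -[x|w] //=; rewrite enum_rankK.
Qed.

(** With [X] taken to be [void], [formula_support] presents a formula as a renaming of one in
    finitely many variables, to which the hypothesis applies. *)
Lemma sat_agree (M N : structure L) V (e : V -> M) (d : V -> N) :
  (forall m (phi : formula L 'I_m) (a : 'I_m -> V),
     sat (e \o a) phi <-> sat (d \o a) phi) ->
  forall phi : formula L V, sat e phi <-> sat d phi.
Proof.
move=> h phi.
have [m [psi [a E]]] := formula_support (inr : V -> void + V) phi.
have key (M' : structure L) (c : V -> M') :
    sat c phi = sat (c \o a) (rename (copair (of_void _) id) psi).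
  transitivity (sat (copair (of_void _) c) (rename inr phi)).
    by rewrite sat_rename.
  by rewrite E !sat_rename; congr sat; apply/funext; case.
by rewrite !key; apply: h.
Qed.

Lemma elementary_sat (M N : structure L) (j : M -> N) :
  elementary_embedding j ->
  forall V (e : V -> M) (phi : formula L V), sat e phi <-> sat (j \o e) phi.
Proof. by move=> jE V e; apply: sat_agree => m phi a; apply: jE. Qed.

Lemma automorphism_sat (C : structure L) (f : C -> C) : automorphism f ->
  forall V (e : V -> C) (phi : formula L V), sat (f \o e) phi <-> sat e phi.
Proof.
case=> -[g fK gK] fF fR V e phi.
have fev W (d : W -> C) t : eval (f \o d) t = f (eval d t).
  by elim: t => //= F u IH; rewrite fF; congr interp_func; apply/funext.
elim: phi e => {V} [V|V t u|V r u|V psi IH1 chi IH2|V psi IH] e //=.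
- by rewrite !fev; split=> [/(can_inj fK)|->].
- have -> : (fun i => eval (f \o e) (u i)) = f \o (fun i => eval e (u i)).
    by apply/funext => i; rewrite /= fev.
  exact: iff_sym (fR r _).
- by split=> h /IH1/h/IH2.
- have E (x : C) : (fun o => oapp (f \o e) (f x) o) = f \o (fun o => oapp e x o).
    by apply/funext; case.
  split=> h x; first by apply/IH; rewrite -E.
  by rewrite -[x]gK E; apply/IH.
Qed.

Lemma automorphism_inv (C : structure L) (f g : C -> C) :
  automorphism f -> cancel f g -> cancel g f -> automorphism g.
Proof.
case=> _ fF fR fK gK; split; first by exists f.
- move=> F a; apply: (can_inj fK); rewrite fF gK; congr interp_func.
  by apply/funext => i /=; rewrite gK.
- move=> r a; rewrite (fR r (g \o a)).
  by have -> : f \o (g \o a) = a by apply/funext => i /=; rewrite gK.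
Qed.

(* A formula is coded by the function sending a node of its syntax tree to the
   symbol at that node. *)
Definition symb (V : Type) : Type :=
  ((func L + rel_symb L) + (option V * nat + nat))%type.

Fixpoint term_code V U (h : V -> option U * nat) (t : term L V) (s : seq nat) :
    option (symb U) :=
  match t, s with
  | tvar v, [::] => Some (inr (inl (h v)))
  | tapp f u, [::] => Some (inl (inl f))
  | tapp f u, i :: s' => if insub i is Some i' then term_code h (u i') s' else None
  | _, _ => None
  end.

(** Labels in the style of De Bruijn: [(None, 0)] is the variable just bound, and crossing a
    quantifier raises the counters of the others. All labels stay in one type while the type of
    variables grows. *)
Definition shift V U (h : V -> option U * nat) (o : option V) : option U * nat :=
  if o is Some v then ((h v).1, (h v).2.+1) else (None, 0%N).

Fixpoint formula_code V U (h : V -> option U * nat) (phi : formula L V)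
    (s : seq nat) : option (symb U) :=
  match phi, s with
  | fbot, [::] => Some (inr (inr 0%N))
  | feq t u, [::] => Some (inr (inr 1%N))
  | fimp _ _, [::] => Some (inr (inr 2%N))
  | fall _, [::] => Some (inr (inr 3%N))
  | fatom r _, [::] => Some (inl (inr r))
  | feq t u, 0%N :: s' => term_code h t s'
  | feq t u, _ :: s' => term_code h u s'
  | fimp psi chi, 0%N :: s' => formula_code h psi s'
  | fimp psi chi, _ :: s' => formula_code h chi s'
  | fall psi, _ :: s' => formula_code (shift h) psi s'
  | fatom r u, i :: s' => if insub i is Some i' then term_code h (u i') s' else None
  | _, _ => None
  end.

Lemma term_code_inj V U (h : V -> option U * nat) : injective h ->
  injective (term_code h).
Proof.
move=> hI; elim=> [v|f u IH] [w|g w] E; have := congr1 (@^~ [::]) E => //=.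
  by move=> [/hI ->].
move=> [fg]; subst g; congr tapp; apply/funext => i; apply: IH.
by apply/funext => s; have := congr1 (@^~ (val i :: s)) E; rewrite /= valK.
Qed.

Lemma formula_code_inj V U (h : V -> option U * nat) : injective h ->
  injective (formula_code h).
Proof.
move=> hI phi.
elim: phi h hI => {V} [V|V t u|V r u|V psi IH1 chi IH2|V psi IH] h hI
  [|t' u'|r' u'|psi' chi'|psi'] E; have := congr1 (@^~ [::]) E => //=.
- move=> _; congr feq; apply: (term_code_inj hI); apply/funext => s.
    by have := congr1 (@^~ (0%N :: s)) E.
  by have := congr1 (@^~ (1%N :: s)) E.
- move=> [rr]; subst r'; congr fatom; apply/funext => i; apply: (term_code_inj hI).
  by apply/funext => s; have := congr1 (@^~ (val i :: s)) E; rewrite /= valK.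
- move=> _; congr fimp; [apply: (IH1 _ hI)|apply: (IH2 _ hI)]; apply/funext => s.
    by have := congr1 (@^~ (0%N :: s)) E.
  by have := congr1 (@^~ (1%N :: s)) E.
- move=> _; congr fall; apply: (IH (shift h)).
    move=> [v|] [w|] //=; case hv: (h v) => [a n]; case hw: (h w) => [b k] //=.
    by move=> [ab nk]; congr Some; apply: hI; rewrite hv hw ab nk.
  by apply/funext => s; have := congr1 (@^~ (0%N :: s)) E.
Qed.

Section Small.
Variable K : Type.
Hypothesis K_large : sufficiently_large L K.

Lemma smallt_symb V : smallt K V -> smallt K (symb V).
Proof.
move=> sV; have [_ _ /small_setT sF /small_setT sR] := K_large.
apply: (smallt_sum K_large); first exact: (smallt_sum K_large).
apply: (smallt_sum K_large); last exact: (smallt_count K_large).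
apply: (smallt_prod K_large); last exact: (smallt_count K_large).
exact: (smallt_option K_large).
Qed.

Lemma smallt_term V : smallt K V -> smallt K (term L V).
Proof.
move=> sV; apply: smallt_embeds (smallt_fun K_large (smallt_count K_large (seq nat))
  (smallt_option K_large (smallt_symb sV))).
exists (term_code (fun v => (Some v, 0%N))); apply: term_code_inj.
by move=> v w [].
Qed.

End Small.
End Syntax.

(** * Small models *)

Section Skolem.
Variables (L : language) (C : structure L) (K : Type).
Hypothesis K_large : sufficiently_large L K.

Definition ext m (a : 'I_m -> C) (x : C) (i : 'I_m.+1) : C :=
  oapp a x (unlift ord0 i).

Lemma skolem_functions :
  exists sk : forall m, formula L 'I_m.+1 -> ('I_m -> C) -> C,
  forall m (psi : formula L 'I_m.+1) a x, sat (ext a x) psi ->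
    sat (ext a (sk m psi a)) psi.
Proof.
have [c0] := carrier_inhabited C.
have /choice[f fP] (z : {m : nat & (formula L 'I_m.+1 * ('I_m -> C))%type}) :
    exists y, forall x, sat (ext (projT2 z).2 x) (projT2 z).1 ->
      sat (ext (projT2 z).2 y) (projT2 z).1.
  case: (pselect (exists x, sat (ext (projT2 z).2 x) (projT2 z).1)) => [[y hy]|n].
    by exists y.
  by exists c0 => x hx; case: n; exists x.
exists (fun m psi a => f (existT _ m (psi, a))) => m psi a x.
exact: (fP (existT _ m (psi, a))).
Qed.

(** The model is the Skolem hull of [A], presented as the set of values of terms over [A] in a
    language [LS] whose symbols name the Skolem functions. Counting terms shows that it is small. *)
Lemma lowenheim_skolem (A : set C) : small K A ->
  exists M : set C, small_model K M /\ A `<=` M.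
Proof.
move=> sA; have [sk skP] := skolem_functions.
pose LS := @Language {m : nat & formula L 'I_m.+1} (@projT1 _ _) void (of_void nat).
have sLS : sufficiently_large LS K.
  case: (K_large) => Ku Kp _ _; split=> //; apply/small_setT.
    apply: smallt_embeds (smallt_prod K_large (smallt_count K_large nat)
      (smallt_fun K_large (smallt_count K_large (seq nat)) (smallt_option K_large
      (smallt_symb K_large (smallt_count K_large void))))).
    exists (fun z => (projT1 z, formula_code (fun i => (None, val i)) (projT2 z))).
    move=> [m phi] [m' phi'] [mm]; subst m'.
    by move=> /formula_code_inj -> // i i' [/val_inj].
  exact: (smallt_count K_large void).
pose S := @Structure LS C (carrier_inhabited C)
  (fun (F : func LS) a => sk (projT1 F) (projT2 F) a) (fun r => match r with end).
pose M : set C := range (fun t : term LS A => eval (M := S) (fun x : A => val x) t).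
have Msk m (psi : formula L 'I_m.+1) (a : 'I_m -> C) :
    (forall i, M (a i)) -> M (sk m psi a).
  move=> Ma; have /choice[t tP] i : exists t : term LS A,
      eval (M := S) (fun x : A => val x) t = a i.
    by have [t _ <-] := Ma i; exists t.
  exists (tapp (f := existT _ m psi : func LS) t) => //=.
  by congr sk; apply/funext => i; rewrite -tP.
have MF (F : func L) (a : 'I_(func_arity F) -> C) :
    (forall i, M (a i)) -> M (interp_func a).
  (* The formula x0 = F(x1, ...) has a unique solution, so its Skolem function computes F. *)
  move=> Ma; pose psi : formula L 'I_(func_arity F).+1 :=
    feq (tvar L ord0) (tapp (fun i => tvar L (lift ord0 i))).
  have psiE x : sat (ext a x) psi <-> x = interp_func a.
    rewrite /= /ext unlift_none /=.
    have -> // : (fun i => oapp a x (unlift ord0 (lift ord0 i))) = a.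
    by apply/funext => i; rewrite liftK.
  have /(skP _ psi)/psiE <- : sat (ext a (interp_func a)) psi by apply/psiE.
  exact: Msk.
have [c0] := carrier_inhabited C.
(* A Skolem function without arguments shows that [M] is nonempty, even when [A] is empty. *)
have M0 : M (sk 0 fbot (fun=> c0)) by apply: Msk; case.
pose N := @Structure L M (inhabits (SigSub (mem_set M0)))
  (fun F a => SigSub (mem_set (MF F (fun i => val (a i)) (fun i => set_mem (valP (a i))))))
  (fun r a => interp_rel (fun i => val (a i))).
exists M; split; last first.
  by move=> x Ax; exists (tvar LS (SigSub (mem_set Ax))).
split.
  by apply: small_range; apply: (smallt_term sLS); apply/small_smallt.
exists N, (fun x : M => val x); split; last first.
  apply/seteqP; split=> [x Mx|_ [x _ <-]]; last exact/set_mem/valP.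
  by exists (SigSub (mem_set Mx)).
have ev V (e : V -> N) t : val (eval e t : M) = eval (M := C) (fun v => val (e v : M)) t.
  by elim: t => //= F u IH; congr interp_func; apply/funext.
(* Skolem functions exist for formulas in ['I_m.+1], while a quantifier turns [V] into [option V].
   Hence [V] is general, but a retract of some ['I_n]. *)
suff H V (psi : formula L V) n (h : V -> 'I_n) (g : 'I_n -> V) (e : V -> N) :
    cancel h g -> sat e psi <-> sat (M := C) (fun v => val (e v : M)) psi.
  by move=> m phi a; apply: (H _ phi m id id).
elim: psi n h g e => {V} [V|V t u|V r u|V psi IH1 chi IH2|V psi IH] n h g e hK //=.
- by rewrite -!ev; split=> [->|/val_inj].
- by under [X in _ <-> interp_rel X]eq_fun do rewrite -ev.
- by split=> H /(IH1 _ _ _ _ hK)/H/(IH2 _ _ _ _ hK).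
pose h' (o : option V) : 'I_n.+1 := oapp (lift ord0 \o h) ord0 o.
pose g' (i : 'I_n.+1) : option V := omap g (unlift ord0 i).
have hK' : cancel h' g'.
  by move=> [v|]; rewrite /g' /= ?liftK ?unlift_none /= ?hK.
have E (x : N) : (fun o => val (oapp e x o : M)) =
    (fun o => oapp (fun v => val (e v : M)) (val (x : M)) o).
  by apply/funext; case.
(* Tarski-Vaught: if [psi] failed at some element of [C], the Skolem function of its negation would
   give a failure in [M]. *)
split=> H x; last by apply/(IH _ _ _ _ hK'); rewrite E.
apply: contrapT => nx.
pose phi := rename h' (fneg psi).
have phiE y : sat (ext (fun i => val (e (g i) : M)) y) phi =
    ~ sat (M := C) (fun o => oapp (fun v => val (e v : M)) y o) psi.
  rewrite sat_rename /=; congr (~ sat _ _); apply/funext => -[v|] /=.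
    by rewrite /ext liftK /= hK.
  by rewrite /ext unlift_none.
have := skP _ phi (fun i => val (e (g i) : M)) x; rewrite !phiE => /(_ nx).
have My : M (sk n phi (fun i => val (e (g i) : M))).
  by apply: Msk => i; apply/set_mem/valP.
apply; have /(IH _ _ _ _ hK') := H (SigSub (mem_set My)).
by rewrite E.
Qed.
End Skolem.

(** * Complete types *)

Lemma finite_set_elim T (P : set T -> Prop) :
  P set0 -> (forall x s, P s -> P (x |` s)) ->
  forall s : set T, finite_set s -> P s.
Proof.
move=> P0 PS s /(@finite_seqP {classic T})[l ->].
elim: l => [|x l IH]; first by rewrite set_nil.
suff -> : [set` x :: l] = x |` [set` l] by apply: PS.
apply/seteqP; split=> y /=; rewrite in_cons.
  by case/orP=> [/eqP ->|?]; [left|right].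
by move=> [->|->]; rewrite ?eqxx ?orbT.
Qed.

Section Types.
Variables (L : language) (C : structure L).

Lemma psat_inst n V (e : 'I_n -> C) (a : V -> C) (psi : formula L ('I_n + V)) :
  psat e (inst a psi) = sat (copair e a) psi.
Proof.
by rewrite /psat sat_rename; congr sat; apply/funext; case.
Qed.

Lemma formula_over_inst n V (A : set C) (a : V -> C) (psi : formula L ('I_n + V)) :
  (forall v, A (a v)) -> formula_over A (inst a psi).
Proof.
move=> Aa; rewrite /inst -(rename_id psi).
have [m [phi [b ->]]] := formula_support (id : 'I_n + V -> _) psi.
exists m, phi, (a \o b); split=> [j|]; first exact: Aa.
by rewrite rename_comp; congr rename; apply/funext; case.
Qed.

Lemma formula_over_sub n (A B : set C) (phi : pformula C n) :
  A `<=` B -> formula_over A phi -> formula_over B phi.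
Proof. by move=> AB [m [psi [a [Aa ->]]]]; exists m, psi, a; split=> // j; apply/AB. Qed.

Lemma formula_over_fneg n (A : set C) (phi : pformula C n) :
  formula_over A phi -> formula_over A (fneg phi).
Proof. by move=> [m [psi [a [Aa ->]]]]; exists m, (fneg psi), a. Qed.

Lemma formula_over_family n V (a : V -> C) (phi : pformula C n) :
  formula_over (range a) phi -> exists psi : formula L ('I_n + V), phi = inst a psi.
Proof.
move=> [m [psi [b [ab ->]]]].
have /choice[b' b'E] j : exists v, a v = b j by have [v _ <-] := ab j; exists v.
exists (rename (copair inl (inr \o b')) psi).
rewrite /inst rename_comp; congr rename.
by apply/funext => -[i|j] //=; rewrite b'E.
Qed.

Lemma consistent_elim3 n (p : set (pformula C n)) phi psi chi :
  consistent p -> p phi -> p psi -> p chi ->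
  exists e : 'I_n -> C, [/\ psat e phi, psat e psi & psat e chi].
Proof.
move=> pc h1 h2 h3.
have [|e he] := pc [set phi; psi; chi] (finite_set3 _ _ _).
  by move=> _ [[]|] ->.
by exists e; split; apply: he; [left; left|left; right|right].
Qed.

Lemma consistent_sub n (p q : set (pformula C n)) :
  p `<=` q -> consistent q -> consistent p.
Proof. by move=> pq qc s fs sp; apply: qc => // x /sp/pq. Qed.

Lemma consistent_directed n (p : set (pformula C n)) :
  p !=set0 ->
  (forall phi, p phi -> exists e, psat e phi) ->
  (forall phi psi, p phi -> p psi -> exists2 chi, p chi &
     forall e, psat e chi -> psat e phi /\ psat e psi) ->
  consistent p.
Proof.
move=> [phi0 pphi0] psat_p pdir s fs sp.
suff [chi pchi chiP] : exists2 chi, p chi &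
    forall e, psat e chi -> forall phi, s phi -> psat e phi.
  by have [e he] := psat_p _ pchi; exists e => phi; apply: chiP.
elim/finite_set_elim: fs sp; first by exists phi0.
move=> phi {}s IH sp; have [|chi pchi chiP] := IH; first by move=> x sx; apply: sp; right.
have [|chi' pchi' chiP'] := pdir phi chi _ pchi; first by apply: sp; left.
by exists chi' => // e /chiP'[h1 h2] psi [->//|]; apply: chiP.
Qed.

Lemma complete_type_neg n (A : set C) (p : set (pformula C n)) phi :
  complete_type A p -> formula_over A phi -> p (fneg phi) <-> ~ p phi.
Proof.
move=> [_ pc pA] Aphi; split=> [h1 h2|h]; last by case: (pA _ Aphi).
by have [e [h3 h4 _]] := consistent_elim3 pc h1 h2 h2; apply: h3.
Qed.

Lemma complete_type_sub n (A B : set C) (p q : set (pformula C n)) phi :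
  complete_type A p -> complete_type B q -> p `<=` q ->
  formula_over A phi -> p phi <-> q phi.
Proof.
move=> [_ _ pA] [_ qc _] pq Aphi; split=> [/pq//|h].
case: (pA _ Aphi) => // /pq h2.
by have [e [h3 h4 _]] := consistent_elim3 qc h h2 h2; case: (h4 h3).
Qed.

Lemma complete_type_restrict n (A B : set C) (q : set (pformula C n)) :
  A `<=` B -> complete_type B q -> complete_type A (q `&` formula_over A).
Proof.
move=> AB [_ qc qB]; split; first by move=> x [].
  by apply: consistent_sub qc => x [].
move=> phi Aphi; case: (qB phi (formula_over_sub AB Aphi)) => h; [left|right] => //.
by split=> //; apply: formula_over_fneg.
Qed.

Lemma ultra_setC T (U : set_system T) (UU : UltraFilter U) (A : set T) :
  U (~` A) <-> ~ U A.
Proof.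
split=> [h1 h2|h]; last by case: (in_ultra_setVsetC A UU).
by have /filter_ex[x []] : U (~` A `&` A) by exact: filterI.
Qed.

(** Some ultrafilter on the tuples of [C] contains the solution set of every finite part of [p]. The
    formulas true almost everywhere form the global type. *)
Lemma global_extension n (p : set (pformula C n)) :
  consistent p -> exists2 g, global_type g & p `<=` g.
Proof.
move=> pc; pose B (s : set (pformula C n)) := [set e | forall phi, s phi -> psat e phi].
have FF : ProperFilter (filter_from [set s | finite_set s /\ s `<=` p] B).
  apply: filter_from_proper; last by move=> s [fs sp]; have [e he] := pc s fs sp; exists e.
  apply: filter_from_filter; first by exists set0; split=> //; apply: finite_set0.
  move=> s t [fs sp] [ft tp]; exists (s `|` t).
    by split; [rewrite finite_setU|rewrite subUset].
  by move=> e he; split=> phi h; apply: he; [left|right].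
have [U [UU FU]] := ultraFilterLemma FF.
exists [set phi | formula_over setT phi /\ U [set e | psat e phi]]; last first.
  move=> phi pphi; split.
    have [m [psi [a E]]] := formula_support id phi.
    by exists m, psi, a; split=> //; rewrite -E rename_id.
  apply: FU; exists [set phi]; last by move=> e; apply.
  by split; [apply: finite_set1|move=> _ ->].
split=> [phi []//| |phi Tphi].
  move=> s fs sg.
  suff /filter_ex[e he] : U [set e | forall phi, s phi -> psat e phi] by exists e.
  elim/finite_set_elim: fs sg => [_|phi {}s IH sg].
    by apply: filterS filterT => e _ phi.
  have h1 : U [set e | psat e phi] by have [] := sg phi (or_introl erefl).
  have h2 : U [set e | forall phi, s phi -> psat e phi].
    by apply: IH => psi spsi; apply: sg; right.
  by apply: filterS (filterI h1 h2) => e [h3 h4] psi [->|/h4].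
case: (in_ultra_setVsetC [set e | psat e phi] UU) => h; [by left|right].
by split=> //; apply: formula_over_fneg.
Qed.
End Types.

(** * Homogeneity and average types *)

Section Monster.
Variables (L : language) (C : structure L) (K : Type).
Hypothesis K_large : sufficiently_large L K.
Hypothesis C_saturated : saturated C K.
Hypothesis C_homogeneous : strongly_homogeneous C K.

(** The formulas x = y are among those preserved, so sending [u x] to [v x] is a well-defined
    elementary map, which strong homogeneity extends. *)
Lemma homogeneous_family V (u v : V -> C) : smallt K V ->
  (forall phi : formula L V, sat u phi <-> sat v phi) ->
  exists2 g : C -> C, automorphism g & forall x, g (u x) = v x.
Proof.
move=> sV uv.
have /choice[f fP] c : exists y, forall x, u x = c -> v x = y.
  case: (pselect (exists x, u x = c)) => [[x <-]|n].
    exists (v x) => y yx.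
    exact: (uv (feq (tvar L y) (tvar L x))).1 yx.
  by exists c => x xc; case: n; exists x.
have fu a : f (u a) = v a by rewrite (fP _ a erefl).
have [||g [gA gf]] := C_homogeneous (A := range u) (f := f).
- exact: small_range.
- move=> m phi a ua.
  have /choice[b bE] j : exists x, u x = a j by have [x _ <-] := ua j; exists x.
  have -> : a = u \o b by apply/funext => j; rewrite /= bE.
  have -> : f \o (u \o b) = v \o b by apply/funext => j /=; rewrite fu.
  by have := uv (rename b phi); rewrite !sat_rename.
exists g => // x; rewrite gf ?fu //; by exists x.
Qed.

Section Average.
Variables (I : Type) (U : set_system I).
Context {UU : UltraFilter U}.

(** The type of [c] is the limit along [U] of the types of the [F i]. *)
Definition realizes_average V (F : I -> V -> C) (c : V -> C) : Prop :=
  forall phi : formula L V, sat c phi <-> U [set i | sat (F i) phi].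

(** The formulas psi(x,c) with psi(f i, F i) true for almost all i form a type over [c]: the
    existential closure of psi in x holds of almost all [F i], hence of [c]. Saturation realizes
    this type. *)
Lemma realize_average1 V (F : I -> V -> C) (c : V -> C) (f : I -> C) :
  smallt K V -> realizes_average F c ->
  exists x, realizes_average (fun i o => oapp (F i) (f i) o) (fun o => oapp c x o).
Proof.
move=> sV cF.
pose d i : 'I_1 + V -> C := copair (fun=> f i) (F i).
pose p : set (pformula C 1) :=
  [set inst c psi | psi in [set psi | U [set i | sat (d i) psi]]].
have pct : complete_type (range c) p.
  split.
  - by move=> _ [psi _ <-]; apply: formula_over_inst => v; exists v.
  - apply: consistent_directed.
    + exists (inst c (fimp fbot fbot)), (fimp fbot fbot) => //.
      by apply: filterS filterT => i _.
    + move=> _ [psi Upsi <-].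
      have [chi chiE] := fexists_tuple psi.
      have /chiE[e he] : sat c chi.
        apply/cF; apply: filterS Upsi => i di.
        by apply/chiE; exists (fun=> f i).
      by exists e; rewrite psat_inst.
    + move=> _ _ [psi Upsi <-] [chi Uchi <-].
      exists (inst c (fand psi chi)).
        exists (fand psi chi) => //.
        by apply: filterS (filterI Upsi Uchi) => i /sat_fand.
      by move=> e; rewrite !psat_inst => /sat_fand.
  - move=> _ /formula_over_family[psi ->].
    case: (in_ultra_setVsetC [set i | sat (d i) psi] UU) => h; [left|right].
      by exists psi.
    by exists (fneg psi).
have [e eP] := C_saturated (small_range c sV) pct.
exists (e ord0) => phi.
pose h (o : option V) : 'I_1 + V := if o is Some v then inr v else inl ord0.
have E1 : sat (fun o => oapp c (e ord0) o) phi = psat e (inst c (rename h phi)).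
  rewrite psat_inst sat_rename; congr sat; by apply/funext => -[].
have E2 i : sat (fun o => oapp (F i) (f i) o) phi = sat (d i) (rename h phi).
  rewrite sat_rename; congr sat; by apply/funext => -[].
rewrite E1; under eq_set do rewrite E2.
split=> [h1|h1]; last by apply: eP; exists (rename h phi).
apply: contrapT => /(ultra_setC UU) h2.
suff /eP : p (inst c (fneg (rename h phi))) by apply.
by exists (fneg (rename h phi)).
Qed.

(** Saturation concerns types in one variable, so the coordinates are realized one at a time, each
    over the previous ones. *)
Lemma realize_average m V (F : I -> V -> C) (c : V -> C) (f : I -> 'I_m -> C) :
  smallt K V -> realizes_average F c ->
  exists x : 'I_m -> C,
    realizes_average (fun i => copair (f i) (F i)) (copair x c).
Proof.
move=> sV cF; elim: m f => [|m IH] f.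
  have drop (x : 'I_0 -> C) (e : V -> C) (phi : formula L ('I_0 + V)) :
      sat (copair x e) phi = sat e (rename (copair (of_ord0 V) id) phi).
    by rewrite sat_rename; congr sat; apply/funext => -[[]|].
  exists (of_ord0 C) => phi; rewrite drop cF.
  by have -> // : [set i | sat (F i) (rename (copair (of_ord0 V) id) phi)] =
    [set i | sat (copair (f i) (F i)) phi] by apply: eq_set => i; rewrite -(drop (f i)).
have [x xP] := IH (fun i j => f i (lift ord0 j)).
have [|y yP] := realize_average1 (fun i => f i ord0) _ xP.
  by apply: (smallt_sum K_large) => //; apply: (smallt_count K_large 'I_m).
exists (fun i => oapp x y (unlift ord0 i)) => phi.
pose h (s : 'I_m.+1 + V) : option ('I_m + V) :=
  match s with inl i => omap inl (unlift ord0 i) | inr v => Some (inr v) end.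
have -> : sat (copair (fun i => oapp x y (unlift ord0 i)) c) phi =
   sat (fun o => oapp (copair x c) y o) (rename h phi).
  rewrite sat_rename; congr sat; apply/funext => -[i|] //=; by case: (unlift _ _).
rewrite yP; under eq_set do rewrite sat_rename.
have -> // : [set i | sat ((fun o => oapp (copair (fun j => f i (lift ord0 j)) (F i))
    (f i ord0) o) \o h) phi] =
   [set i | sat (copair (f i) (F i)) phi].
apply: eq_set => i; congr sat; apply/funext => -[j|] //=.
by case: unliftP => [k ->|->].
Qed.

Lemma realize_average_cst m V (c : V -> C) (f : I -> 'I_m -> C) : smallt K V ->
  exists x : 'I_m -> C, forall phi : formula L ('I_m + V),
    sat (copair x c) phi <-> U [set i | sat (copair (f i) c) phi].
Proof.
move=> sV; apply: (realize_average (F := fun=> c)) => // phi.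
split=> [h|/filter_ex[]//]; by apply: filterS filterT.
Qed.

End Average.

Section Model.
Variables (N : structure L) (j : N -> C).
Hypothesis jE : elementary_embedding j.

Definition same_type m (a b : 'I_m -> C) : Prop :=
  forall phi : formula L ('I_m + N), sat (copair a j) phi <-> sat (copair b j) phi.

Hypothesis jsmall : small K (range j).

Lemma smallt_model : smallt K N.
Proof.
apply/small_setT; apply: small_le jsmall; apply/card_le_embeds.
exists (fun x : [set: N] =>
  SigSub (mem_set (ex_intro2 _ _ (val x) I erefl : range j (j (val x))))).
move=> x y [] jxy; apply: val_inj.
(* Elementarity for the formula x0 = x1 makes [j] injective. *)
exact: ((jE (feq (tvar L ord0) (tvar L ord_max))
  (fun i : 'I_2 => if i == ord0 then val x else val y)).2 jxy).
Qed.

Lemma same_type_Lascar (A : set C) m (a b : 'I_m -> C) :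
  A `<=` range j -> same_type a b -> Lascar_equiv K A a b.
Proof.
move=> Aj /homogeneous_family[|g gA gab].
  by apply: (smallt_sum K_large) (smallt_model); apply: (smallt_count K_large 'I_m).
exists g; split; last by move=> i; apply: (gab (inl i)).
apply: (@Autf_model _ _ _ _ (range j)) => //; first by split=> //; exists N, j.
by move=> _ [x _ <-]; apply: (gab (inr x)).
Qed.

(** By elementarity tp(a/N) is finitely satisfiable in N, so some ultrafilter contains the solution
    sets in N of all its formulas, and tp(a/N) is its average. *)
Lemma coheir m (a : 'I_m -> C) :
  exists2 U : set_system ('I_m -> N), UltraFilter U &
    forall phi : formula L ('I_m + N),
      sat (copair a j) phi <-> U [set n | sat (copair (j \o n) j) phi].
Proof.
pose D : set (formula L ('I_m + N)) := [set phi | sat (copair a j) phi].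
pose B phi := [set n : 'I_m -> N | sat (copair (j \o n) j) phi].
have FF : ProperFilter (filter_from D B).
  apply: filter_from_proper.
    apply: filter_from_filter; first by exists (fimp fbot fbot).
    move=> phi psi Dphi Dpsi; exists (fand phi psi); first exact/sat_fand.
    by move=> n /sat_fand.
  move=> phi Dphi; have [psi psiE] := fexists_tuple phi.
  have /(elementary_sat jE id)/psiE[n nP] : sat (j \o id) psi.
    by apply/psiE; exists a.
  exists n; move/(elementary_sat jE): nP; congr sat.
  by apply/funext; case.
have [U [UU FU]] := ultraFilterLemma FF.
exists U => // phi; split=> [h|h]; first by apply: FU; exists phi.
apply: contrapT => nh.
have h' : U (~` B phi) by apply: FU; exists (fneg phi).
by have /filter_ex[x []] : U (~` B phi `&` B phi) by exact: filterI.
Qed.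

End Model.
End Monster.

(** * Strong bounded multiplicity *)

Lemma infinite_sequence T (A : set T) : infinite_set A ->
  exists f : nat -> T, injective f /\ forall n, A (f n).
Proof.
move=> /infiniteP/card_le_embeds[f fI].
exists (fun n => val (f (SigSub (mem_set (I : [set: nat] n))))).
split=> [m n /val_inj/fI[]//|n]; exact/set_mem/valP.
Qed.

Lemma small_cardinal K X : smallt K X -> exists kappa : set K, small K kappa /\
  forall T (F : set T), embeds F X -> F #<= kappa.
Proof.
move=> sX; have [[f fI] _] := sX.
exists (range f); split; first exact: small_range.
move=> T F [h hI]; apply/card_le_embeds.
exists (fun t => SigSub (mem_set (ex_intro2 _ _ (h t) I erefl : range f (f (h t))))).
by move=> x y [] /fI/hI.
Qed.

(** * Coding the global types that do not Lascar-split over [A] *)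

Section Invariants.
Variables (L : language) (C : structure L) (K : Type).
Hypothesis K_large : sufficiently_large L K.
Hypothesis C_homogeneous : strongly_homogeneous C K.
Variables (N : structure L) (j : N -> C) (A : set C) (n : nat).
Hypotheses (jE : elementary_embedding j) (jsmall : small K (range j))
  (Aj : A `<=` range j).

(** An element is a set of triples: m, a code of phi, and the coded tp(b/N). With codes in place of
    formulas, the triples for all m lie in one type. *)
Definition invariants : Type :=
  set (nat * (seq nat -> option (symb L void)) * set (seq nat -> option (symb L N))).

Lemma smallt_invariants : smallt K invariants.
Proof.
have sc V : smallt K V -> smallt K (seq nat -> option (symb L V)).
  move=> sV; apply: (smallt_fun K_large); first exact: (smallt_count K_large).
  by apply: (smallt_option K_large); apply: smallt_symb.
apply: (smallt_power K_large); apply: (smallt_prod K_large).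
  apply: (smallt_prod K_large); first exact: (smallt_count K_large).
  by apply: sc; apply: (smallt_count K_large void).
by apply: (smallt_power K_large); apply: sc; apply: smallt_model jE jsmall.
Qed.

Definition phi_code m : formula L ('I_n + 'I_m) -> seq nat -> option (symb L void) :=
  formula_code (fun s => (None, pickle s)).

Definition tp_code m (b : 'I_m -> C) : set (seq nat -> option (symb L N)) :=
  formula_code (copair (fun i => (None, val i)) (fun x => (Some x, 0%N))) @`
    [set phi | sat (copair b j) phi].

Lemma phi_code_inj m : injective (@phi_code m).
Proof. by apply: formula_code_inj => x y [] /(pcan_inj pickleK). Qed.

Lemma tp_code_inj m (a b : 'I_m -> C) : tp_code a = tp_code b -> same_type j a b.
Proof.
have cI : injective (copair (fun i : 'I_m => (None, val i)) (fun x : N => (Some x, 0%N))).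
  by move=> [i|x] [i'|x'] [] // => [/val_inj|] ->.
suff sub (c d : 'I_m -> C) : tp_code c `<=` tp_code d ->
    forall phi, sat (copair c j) phi -> sat (copair d j) phi.
  by move=> /seteqP[ab ba] phi; split; apply: sub.
move=> cd phi hphi.
have [psi hpsi /(formula_code_inj cI) <- //] : tp_code d
  (formula_code (copair (fun i => (None, val i)) (fun x => (Some x, 0%N))) phi).
by apply: cd; exists phi.
Qed.

Definition invariant (g : set (pformula C n)) : invariants :=
  [set u | exists m (phi : formula L ('I_n + 'I_m)) (b : 'I_m -> C),
     g (inst b phi) /\ u = (m, phi_code phi, tp_code b)].

(** If phi(x,b) is in [g], equality of the invariants gives b' with the same type as b over the
    model and phi(x,b') in [h]. Then b and b' are Lascar-equivalent, and [h] would split if it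
    omitted phi(x,b). *)
Lemma invariant_inj (g h : set (pformula C n)) :
  global_type g -> global_type h ->
  ~ Lascar_splits K A setT g -> ~ Lascar_splits K A setT h ->
  invariant g = invariant h -> g = h.
Proof.
suff sub (g' h' : set (pformula C n)) : global_type g' -> global_type h' ->
    ~ Lascar_splits K A setT h' -> invariant g' = invariant h' -> g' `<=` h'.
  by move=> gt ht gs hs gh; apply/seteqP; split; apply: sub.
move=> gt ht hs gh phi gphi; have [gT _ _] := gt.
have [m [psi [b [_ E]]]] := gT _ gphi; subst phi.
have : invariant g' (m, phi_code psi, tp_code b) by exists m, psi, b.
rewrite gh => -[m' [psi' [b' [hb []]]]] mm; subst m'.
move=> /phi_code_inj ? /tp_code_inj bb; subst psi'.
have [_ _ hT] := ht; apply: contrapT => nh; apply: hs.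
exists m, psi, b', b; split=> //; last first.
  by case: (hT (inst b psi)) => //; apply: formula_over_inst.
apply: (same_type_Lascar K_large C_homogeneous jE jsmall Aj) => chi.
exact: iff_sym (bb chi).
Qed.

End Invariants.

Section Rank.
Variables (L : language) (C : structure L) (K : Type) (W : Type)
  (lt : W -> W -> Prop) (cls : forall n, set (set (pformula C n)))
  (R : forall n, set (pformula C n) -> option W).
Hypothesis K_large : sufficiently_large L K.
Hypothesis C_homogeneous : strongly_homogeneous C K.
Hypothesis lt_wo : well_order lt.
Hypothesis cls_class : type_class K cls.
Hypothesis R_rank : is_rank lt cls R.

Lemma rank_lt_irr x : ~ rank_lt lt x x.
Proof.
case: lt_wo => wf _ _; case: x => [a|] //=.
by elim: (wf a) => {}a _ IH aa; apply: (IH a aa).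
Qed.

Lemma Lascar_splitting_rank_strong_bounded :
  Lascar_splitting_rank K lt cls R -> strong_bounded_multiplicity K cls R.
Proof.
move=> RL n p k clsp rp _.
case: cls_class => dom up _; have [A sA Ap] := dom n p clsp.
have [M [[sM [N [j [jE Mj]]]] AM]] := lowenheim_skolem K_large sA.
subst M; have sI := smallt_invariants K_large jE sM.
have [kappa [skappa kappaP]] :=
  small_cardinal (smallt_prod K_large sI (smallt_count K_large nat)).
exists kappa; split=> // F FP Finc; apply: kappaP.
have /choice[G GP] q : exists g, F q ->
    [/\ global_type g, q `<=` g & ~ Lascar_splits K A setT g].
  case: (pselect (F q)) => [Fq|nF]; last by exists set0.
  have [[B sB Bq] pq Rq] := FP q Fq.
  (* If every global extension of [q] split over [A], then [q] would have smaller rank than [p]. *)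
  apply: contrapT => nog; apply: (@rank_lt_irr (R p)).
  rewrite -{1}Rq; apply: (RL n A B) => //; first exact: up sB Bq pq.
  move=> g gg qg; apply: contrapT => gs; apply: nog; by exists g.
(* An infinite fibre has [k] distinct members; by [invariant_inj] they all lie in one global type,
   so their union is consistent. *)
apply: (finite_fibres_embeds (G := fun q => invariant j (G q))) => u.
apply: contrapT => /infinite_sequence[f [fI fP]].
apply: (Finc (fun i : 'I_k => f i)).
- by move=> x y /fI/val_inj.
- by move=> i; case: (fP i).
have [[_ gc _] _ _] := GP _ (fP 0%N).1.
apply: consistent_sub gc => phi [i _ fphi].
have [g0 _ s0] := GP _ (fP 0%N).1; have [gi qi si] := GP _ (fP i).1.
rewrite -(invariant_inj K_large C_homogeneous jE sM AM gi g0 si s0); first exact: qi.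
by rewrite (fP i).2 (fP 0%N).2.
Qed.

End Rank.

(** * Invariance under Lascar equivalence *)

Lemma cantor_embeds T : ~ embeds (set T) T.
Proof.
move=> [f fI]; pose D := [set x | exists2 X, x = f X & ~ X x].
have nD : ~ D (f D) by move=> h; case: (h) => X /fI <-.
by apply: (nD); exists D.
Qed.

(** * Conjugation of types by automorphisms *)

Section Conjugation.
Variables (L : language) (C : structure L).

Lemma inst_comp V P Q S (a : P -> Q) (b : Q -> S) (phi : formula L (V + P)) :
  inst b (inst a phi) = inst (b \o a) phi.
Proof. by rewrite /inst rename_comp; congr rename; apply/funext; case. Qed.

Lemma inst_id V P (a : P -> P) (phi : formula L (V + P)) : a =1 id -> inst a phi = phi.
Proof.
move=> aid; rewrite -[RHS]rename_id; congr rename; apply/funext => -[|] //= x.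
by rewrite aid.
Qed.

Lemma psat_automorphism n (f : C -> C) (e : 'I_n -> C) (phi : pformula C n) :
  automorphism f -> psat (f \o e) (inst f phi) <-> psat e phi.
Proof.
move=> fA; rewrite psat_inst -[psat e phi](automorphism_sat fA).
by have -> : copair (f \o e) f =
  f \o (fun s => match s with inl i => e i | inr c => c end) by apply/funext; case.
Qed.

Lemma conj_typeE n (f g : C -> C) (q : set (pformula C n)) chi :
  cancel f g -> cancel g f -> conj_type g q chi <-> q (inst f chi).
Proof.
move=> fK gK; split=> [[phi qphi <-]|h].
  by rewrite inst_comp inst_id.
by exists (inst f chi) => //; rewrite inst_comp inst_id.
Qed.

Lemma complete_type_conj n (g : C -> C) (A : set C) (q : set (pformula C n)) :
  automorphism g -> complete_type A q -> complete_type (g @` A) (conj_type g q).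
Proof.
move=> gA [qA qc qcpl]; have [[f gK fK] _ _] := gA; split.
- move=> _ [phi qphi <-]; have [m [psi [a [Aa ->]]]] := qA _ qphi.
  exists m, psi, (g \o a); split; last by rewrite inst_comp.
  by move=> i; exists (a i).
- move=> s fs sq; have [|_ [phi sphi <-]|e he] := qc (inst f @` s).
  + exact: finite_image.
  + by apply/(conj_typeE _ _ fK gK); apply: sq.
  exists (g \o e) => phi sphi; have -> : phi = inst g (inst f phi).
    by rewrite inst_comp inst_id.
  by apply/psat_automorphism => //; apply: he; exists phi.
- move=> phi [m [psi [a [Aa E]]]].
  have : formula_over A (inst f phi).
    rewrite E inst_comp; apply: formula_over_inst => i /=.
    by have [c Ac <-] := Aa i; rewrite gK.
  by case/qcpl => h; [left|right]; apply/(conj_typeE _ _ fK gK).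
Qed.

End Conjugation.

(** * Extensions of the same rank and indistinguishable tuples *)

Section Rank.
Variables (L : language) (C : structure L) (K : Type) (W : Type)
  (lt : W -> W -> Prop) (cls : forall n, set (set (pformula C n)))
  (R : forall n, set (pformula C n) -> option W).
Hypothesis K_large : sufficiently_large L K.
Hypothesis C_saturated : saturated C K.
Hypothesis C_homogeneous : strongly_homogeneous C K.
Hypothesis lt_wo : well_order lt.
Hypothesis cls_class : type_class K cls.
Hypothesis R_rank : is_rank lt cls R.

Lemma rank_le_anti x y : rank_le lt x y -> rank_le lt y x -> x = y.
Proof.
move=> [//|xy] [//|yx]; exfalso; apply: (@rank_lt_irr _ lt lt_wo x).
case: lt_wo => _ tr _; case: x y xy yx => [a|] [b|] //=; exact: tr.
Qed.

Hypothesis R_bounded : bounded_multiplicity K cls R.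
Hypothesis R_extension : has_extension K cls R.

Section Fixed.
Variables (n : nat) (A : set C) (p : set (pformula C n)).
Hypotheses (sA : small K A) (Ap : complete_type A p) (clsp : cls p)
  (rp : ranked R p).

Definition same_rank (D : set C) : set (set (pformula C n)) :=
  [set q | [/\ complete_type D q, p `<=` q & R q = R p]].

Lemma same_rank_cls D q : small K D -> same_rank D q -> cls q.
Proof. by case: cls_class => _ up _ sD [Dq pq _]; exact: up _ _ _ _ clsp sD Dq pq. Qed.

Lemma same_rank_extend D D' q : small K D -> small K D' -> D `<=` D' ->
  same_rank D q -> exists2 q', same_rank D' q' & q `<=` q'.
Proof.
move=> sD sD' DD' qX; have [Dq pq Rq] := qX.
have [|q' [D'q' qq' Rq']] := R_extension sD Dq (same_rank_cls sD qX) _ sD' DD'.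
  by rewrite /ranked Rq.
exists q' => //; split=> //; [exact: subset_trans qq'|by rewrite Rq'].
Qed.

(** By Heredity the rank of the restriction lies between those of [q] and [p], which are equal. *)
Lemma same_rank_restrict D D' q : small K D -> small K D' -> A `<=` D -> D `<=` D' ->
  same_rank D' q -> same_rank D (q `&` formula_over D).
Proof.
move=> sD sD' AD DD' qX; have [D'q pq Rq] := qX.
case: cls_class => _ up _.
have Dr := complete_type_restrict DD' D'q.
have pr : p `<=` q `&` formula_over D.
  move=> x px; split; first exact: pq.
  by have [pA _ _] := Ap; apply: formula_over_sub AD (pA _ px).
have clsr := up _ _ _ _ clsp sD Dr pr.
split=> //; case: R_rank => her _; apply: rank_le_anti; first exact: her.
by rewrite -Rq; apply: her => //; exact: same_rank_cls qX.
Qed.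

Section Formula.
Variables (m : nat) (phi : formula L ('I_n + 'I_m)).

Definition agree (D : set C) (a b : 'I_m -> C) : Prop :=
  forall q, same_rank D q -> q (inst a phi) <-> q (inst b phi).

(** Ranging over all [D] makes the relation visibly invariant under automorphisms fixing [A];
    [indist_agree] then reduces it to a single [D]. *)
Definition indist (a b : 'I_m -> C) : Prop :=
  forall D, small K D -> A `<=` D -> range a `<=` D -> range b `<=` D -> agree D a b.

(* By Extension, every member of [same_rank D] is the restriction of a member of
   [same_rank D'] for larger [D']. *)
Lemma indist_agree D a b : small K D -> A `<=` D -> range a `<=` D ->
  range b `<=` D -> agree D a b -> indist a b.
Proof.
move=> sD AD aD bD ab D' sD' AD' aD' bD' q qX.
have sU := small_setU K_large sD sD'.
have [q' q'X qq'] := same_rank_extend sD' sU (@subsetUr _ D D') qX.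
have rX := same_rank_restrict sD sU AD (@subsetUl _ D D') q'X.
have [D'q _ _] := qX; have [Uq' _ _] := q'X.
have over (E : set C) (c : 'I_m -> C) : range c `<=` E -> formula_over E (inst c phi).
  by move=> cE; apply: formula_over_inst => v; apply: cE; exists v.
rewrite (complete_type_sub D'q Uq' qq' (over _ _ aD')).
rewrite (complete_type_sub D'q Uq' qq' (over _ _ bD')).
have := ab _ rX => -[h1 h2]; split=> h.
  by case: h1 => //; split=> //; apply: over.
by case: h2 => //; split=> //; apply: over.
Qed.

Lemma indist_sym a b : indist a b -> indist b a.
Proof. by move=> ab D sD AD bD aD q qX; exact: iff_sym (ab D sD AD aD bD q qX). Qed.

(** A set containing [a] and [c] may miss [b], so the comparison is made over a set containing all
    three. *)
Lemma indist_trans a b c : indist a b -> indist b c -> indist a c.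
Proof.
move=> ab bc; pose D := A `|` (range a `|` (range b `|` range c)).
have sD : small K D.
  apply: (small_setU K_large) => //.
  apply: (small_setU K_large); first exact: (small_tuple K_large).
  by apply: (small_setU K_large); exact: (small_tuple K_large).
have AD : A `<=` D by move=> x; left.
have aD : range a `<=` D by move=> x; right; left.
have bD : range b `<=` D by move=> x; right; right; left.
have cD : range c `<=` D by move=> x; right; right; right.
apply: (indist_agree sD) => // q qX.
exact: iff_trans (ab D sD AD aD bD q qX) (bc D sD AD bD cD q qX).
Qed.

(** Conjugation by the inverse [g] of [f] carries same-rank extensions of [p] over [D] to such
    extensions over the image of [D], because [g] fixes [A] and hence [p]. *)
Lemma indist_automorphism f a b : automorphism f -> (forall x, A x -> f x = x) ->
  indist a b -> indist (f \o a) (f \o b).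
Proof.
move=> fA fix_A ab D sD AD aD bD q qX; have [[g fK gK] _ _] := fA.
have gA := automorphism_inv fA fK gK.
have gq c : q (inst (f \o c) phi) <-> conj_type g q (inst c phi).
  by rewrite (conj_typeE _ _ fK gK) inst_comp.
rewrite !gq; apply: (ab (g @` D)).
- exact: small_image.
- by move=> x Ax; exists x; [exact: AD|rewrite -{1}(fix_A x Ax) fK].
- by move=> _ [i _ <-]; exists (f (a i)); [apply: aD; exists i|rewrite fK].
- by move=> _ [i _ <-]; exists (f (b i)); [apply: bD; exists i|rewrite fK].
have [Dq pq Rq] := qX; split; first exact: complete_type_conj.
  move=> x px; apply/(conj_typeE _ _ fK gK); apply: pq.
  have [pA _ _] := Ap; have [k [psi [c [Ac E]]]] := pA _ px.
  have -> // : inst f x = x; rewrite E inst_comp.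
  by congr inst; apply/funext => i /=; rewrite fix_A.
by case: R_rank => _ iso; rewrite -iso //; exact: same_rank_cls qX.
Qed.

(** Otherwise there would be 2^(2^kappa) pairwise distinguishable tuples. Over one small set
    containing them, the at most kappa same-rank extensions would separate them by subsets of kappa,
    against Cantor's theorem. *)
Lemma indist_representatives : exists rep : ('I_m -> C) -> 'I_m -> C,
  (forall c, indist c (rep c)) /\ small K (range rep).
Proof.
have indist_refl c : indist c c by [].
have [c0] := carrier_inhabited C.
(* The choice depends on the class as a set, so that indistinguishable tuples get the same
   representative. *)
have /choice[pick pickP] (S : set ('I_m -> C)) : exists y, forall x, S x -> S y.
  case: (pselect (S !=set0)) => [[y Sy]|S0]; first by exists y.
  by exists (fun=> c0) => x Sx; case: S0; exists x.
pose rep c := pick (indist c).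
have repP c : indist c (rep c) by apply: (pickP (indist c) c).
have rep_eq c d : indist c d -> rep c = rep d.
  move=> cd; congr pick; apply/funext => x; apply/propext; split=> h.
    exact: indist_trans (indist_sym cd) h.
  exact: indist_trans cd h.
exists rep; split=> //.
have [kappa [/small_smallt skappa kappaP]] := R_bounded sA Ap clsp rp.
have sP := smallt_power K_large (smallt_power K_large skappa).
case: (embeds_total (range rep) (set (set kappa))) => [h|[h hI]].
  by apply/small_smallt; apply: smallt_embeds h sP.
exfalso; apply: (@cantor_embeds (set kappa)).
pose y t : 'I_m -> C := val (h t).
pose D := A `|` range (fun z : set (set kappa) * 'I_m => y z.1 z.2).
have sD : small K D.
  apply: (small_setU K_large) => //; apply: small_range.
  by apply: (smallt_prod K_large) => //; apply: (smallt_count K_large 'I_m).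
have AD : A `<=` D by move=> x; left.
have yD t : range (y t) `<=` D by move=> _ [i _ <-]; right; exists (t, i).
have /card_le_embeds[iota iotaI] := kappaP D sD AD.
(* A tuple is coded by the set of same-rank types over [D] containing its instance of [phi]; equal
   codes mean agreement over [D]. *)
exists (fun t => [set k | exists q, iota q = k /\ val q (inst (y t) phi)]).
move=> t t' /seteqP[tt1 tt2].
have : indist (y t) (y t').
  apply: (indist_agree sD) => // q qX.
  pose q' : [set q | [/\ complete_type D q, p `<=` q & R q = R p]] := SigSub (mem_set qX).
  split=> hq.
    have [|q1 [/iotaI ->]] := tt1 (iota q'); by [exists q'|].
  have [|q1 [/iotaI ->]] := tt2 (iota q'); by [exists q'|].
move=> tt; apply/hI/val_inj.
have /set_mem[c _ cE] := valP (h t); have /set_mem[c' _ cE'] := valP (h t').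
rewrite -cE -cE' (rep_eq _ _ (repP c)) (rep_eq _ _ (repP c')).
by apply: rep_eq; rewrite cE cE'.
Qed.

Section Model.
Variables (N : structure L) (j : N -> C).
Hypotheses (jE : elementary_embedding j) (jsmall : small K (range j))
  (Aj : A `<=` range j).

(* [c] and [c'] realize a coheir of tp(a/N) over sets meeting all classes of
   [indist], so [c], [c'] are indistinguishable; and the pairs (c,c'), (a,c') and
   (b,c') have the same type over N. *)
Lemma same_type_indist a b : same_type j a b -> indist a b.
Proof.
move=> ab; have [rep [repP srep]] := indist_representatives.
have [U UU UP] := coheir jE a.
(* All representatives are put into [D] before [c] is chosen, so that [rep c] is in [D] whatever [c]
   is. *)
pose D := range j `|` (range a `|` (range b `|`
  range (fun z : range rep * 'I_m => (val z.1 : 'I_m -> C) z.2))).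
have sD : small K D.
  apply: (small_setU K_large) => //.
  do 2![apply: (small_setU K_large); first exact: (small_tuple K_large)].
  apply: small_range; apply: (smallt_prod K_large); first exact/small_smallt.
  exact: (smallt_count K_large 'I_m).
have stD : smallt K D by apply/small_smallt.
pose d (x : D) : C := val x.
have dE V (e : V -> C) : (forall v, D (e v)) -> exists h : V -> D, e = d \o h.
  move=> De; exists (fun v => SigSub (mem_set (De v))); exact/funext.
have stDm : smallt K ('I_m + D).
  by apply: (smallt_sum K_large) => //; apply: (smallt_count K_large 'I_m).
have [c cP] := realize_average_cst K_large C_saturated d (fun t => j \o t) stD.
have [c' c'P] := realize_average_cst K_large C_saturated (copair c d) (fun t => j \o t) stDm.
have [jd jdE] : exists h : N -> D, j = d \o h.
  by apply: dE => x; left; exists x.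
have [ad adE] : exists h : 'I_m -> D, a = d \o h.
  by apply: dE => i; right; left; exists i.
have [bd bdE] : exists h : 'I_m -> D, b = d \o h.
  by apply: dE => i; right; right; left; exists i.
have [rd rdE] : exists h : 'I_m -> D, rep c = d \o h.
  apply: dE => i; right; right; right.
  by exists (SigSub (mem_set (ex_intro2 _ _ c I erefl : range rep (rep c))), i).
(* An automorphism fixing [D] and sending [c] to [c'] also fixes [rep c], so both tuples are
   indistinguishable from [rep c]. *)
have cc' : indist c c'.
  have [g gA gE] : exists2 g : C -> C, automorphism g &
      forall x, g (copair c d x) = copair c' d x.
    apply: (homogeneous_family C_homogeneous) => // chi; rewrite cP.
    have := c'P (rename (copair inl (inr \o inr)) chi).
    rewrite sat_rename.
    have -> : copair c' (copair c d) \o copair inl (inr \o inr) = copair c' d.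
      by apply/funext; case.
    move=> ->; have -> // : [set t | sat (copair (j \o t) (copair c d))
        (rename (copair inl (inr \o inr)) chi)] = [set t | sat (copair (j \o t) d) chi].
    apply: eq_set => t; rewrite sat_rename; congr sat; by apply/funext; case.
  have gd x : g (d x) = d x by exact: gE (inr x).
  have gA' x : A x -> g x = x.
    by move=> /Aj[y _ <-]; rewrite jdE /= gd.
  have := indist_automorphism gA gA' (repP c).
  have -> : g \o c = c' by apply/funext => i; exact: gE (inl i).
  have -> : g \o rep c = rep c by rewrite rdE; apply/funext => i /=; rewrite gd.
  by move=> h; apply: indist_trans (repP c) (indist_sym h).
have ca : same_type j c a.
  move=> chi; rewrite UP; have := cP (rename (copair inl (inr \o jd)) chi).
  rewrite sat_rename.
  have E (e : 'I_m -> C) : copair e d \o copair inl (inr \o jd) = copair e j.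
    by rewrite jdE; apply/funext; case.
  rewrite E => ->.
  have -> // : [set t | sat (copair (j \o t) d) (rename (copair inl (inr \o jd)) chi)]
    = [set t | sat (copair (j \o t) j) chi].
  by apply: eq_set => t; rewrite sat_rename E.
(* The type of [c'] over [D] and [c] is an average of tuples from N, which cannot tell [c] from [e].
   So an automorphism fixing N and [c'] sends [c] to [e], and it transports [cc']. *)
have to_c' e (ed : 'I_m -> D) : e = d \o ed -> same_type j c e -> indist e c'.
  move=> eE ce.
  have [g gA gE] : exists2 g : C -> C, automorphism g &
      forall x, g (copair c' (copair c j) x) = copair c' (copair e j) x.
    apply: (homogeneous_family C_homogeneous) => [|chi].
      apply: (smallt_sum K_large); first exact: (smallt_count K_large 'I_m).
      apply: (smallt_sum K_large); first exact: (smallt_count K_large 'I_m).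
      exact: smallt_model jE jsmall.
    pose hc : 'I_m + ('I_m + N) -> 'I_m + ('I_m + D) :=
      copair inl (inr \o copair inl (inr \o jd)).
    pose he : 'I_m + ('I_m + N) -> 'I_m + ('I_m + D) :=
      copair inl (inr \o copair (inr \o ed) (inr \o jd)).
    have hcE (x : 'I_m -> C) : copair x (copair c d) \o hc = copair x (copair c j).
      by rewrite jdE; apply/funext => -[|[]].
    have heE (x : 'I_m -> C) : copair x (copair c d) \o he = copair x (copair e j).
      by rewrite jdE eE; apply/funext => -[|[]].
    have := c'P (rename hc chi); have := c'P (rename he chi).
    rewrite !sat_rename hcE heE => -> ->.
    have -> // : [set t | sat (copair (j \o t) (copair c d)) (rename hc chi)] =
      [set t | sat (copair (j \o t) (copair c d)) (rename he chi)].
    apply: eq_set => t; rewrite !sat_rename hcE heE; apply/propext.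
    have := ce (rename (copair (inr \o t) id) chi).
    have E (x : 'I_m -> C) : copair x j \o copair (inr \o t) id = copair (j \o t) (copair x j).
      by apply/funext; case.
    by rewrite !sat_rename !E.
  have gA' x : A x -> g x = x.
    by move=> /Aj[y _ <-]; exact: gE (inr (inr y)).
  have := indist_automorphism gA gA' cc'.
  have -> : g \o c = e by apply/funext => i; exact: gE (inr (inl i)).
  by have -> : g \o c' = c' by apply/funext => i; exact: gE (inl i).
apply: indist_trans (to_c' _ _ adE ca) (indist_sym (to_c' _ _ bdE _)).
by move=> chi; rewrite ca.
Qed.

End Model.

(** Induction on the generation of [Autf], with the tuple varying: a generator preserves types over
    the model it fixes, a composition is handled by transitivity and an inverse by symmetry. *)
Lemma Lascar_equiv_indist a b : Lascar_equiv K A a b -> indist a b.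
Proof.
move=> [f [fA fab]]; have {fab b} -> : b = f \o a by apply/funext => i; rewrite -fab.
elim: fA a => {f} [M f [sM [N [j [jE Mj]]]] AM fA fM||f g _ IHf _ IHg|f g _ IH fK gK] a //.
- subst M; apply: (same_type_indist jE sM AM) => chi.
  rewrite -(automorphism_sat fA).
  have -> // : f \o copair a j = copair (f \o a) j.
  by apply/funext => -[|x] //=; rewrite fM //; exists x.
- exact: indist_trans (IHg a) (IHf (g \o a)).
- have := IH (g \o a); have -> : f \o (g \o a) = a by apply/funext => i /=.
  exact: indist_sym.
Qed.

End Formula.
End Fixed.

Lemma bounded_extension_Lascar_splitting_rank : Lascar_splitting_rank K lt cls R.
Proof.
move=> n A B p q sA sB Ap Bq clsp clsq pq rp qsplit.
(* Heredity leaves only the case R q = R p to refute. *)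
case: R_rank => her _; case: (her _ _ _ clsp clsq pq) => // Rq; exfalso.
have qX : same_rank p B q by [].
have AB : A `<=` B.
  have [_ _ pA] := Ap; have [qB _ _] := Bq.
  (* The formula x = x or its negation is in [p], hence in [q], so it is a formula over [B]; its
     parameter is read off from the syntax. *)
  move=> x Ax; pose phi : pformula C n := feq (tvar L (inr x)) (tvar L (inr x)).
  have Aphi : formula_over A phi.
    pose psi : formula L ('I_n + unit) := feq (tvar L (inr tt)) (tvar L (inr tt)).
    exact: (@formula_over_inst _ _ _ _ A (fun=> x) psi).
  have {Aphi} : formula_over B phi \/ formula_over B (fneg phi).
    by case: (pA _ Aphi) => /pq/qB; [left|right].
  have feqP m (psi : formula L ('I_n + 'I_m)) a :
      (forall i, B (a i)) -> phi = inst a psi -> B x.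
    by move=> Ba; case: psi => //= t u []; case: t => [[i|i]|] //= [->].
  case=> -[m [psi [a [Ba]]]]; first exact: feqP.
  by case: psi => //= psi chi [/(feqP _ _ _ Ba)].
(* No global type containing [S] Lascar-splits over [A], so a global completion of [q] and [S]
   contradicts [qsplit]. *)
pose S : set (pformula C n) := [set chi | exists m (phi : formula L ('I_n + 'I_m)) a b,
  Lascar_equiv K A a b /\ chi = fimp (inst a phi) (inst b phi)].
suff /global_extension[g gg Sg] : consistent (q `|` S).
  have [|m [phi [a [b [_ ab ga gb]]]]] := qsplit g gg; first by move=> x qx; apply: Sg; left.
  have gS : g (fimp (inst a phi) (inst b phi)) by apply: Sg; right; exists m, phi, a, b.
  have [_ gc _] := gg; have [e [h1 h2 h3]] := consistent_elim3 gc ga gb gS.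
  exact/h2/h3.
move=> s fs sqS.
(* [D] is obtained from [B] by adding the tuples of the finitely many formulas of [S] that occur in
   [s]. *)
have [D [sD BD sDP]] : exists D, [/\ small K D, B `<=` D &
    forall q', same_rank p D q' -> q `<=` q' -> s `<=` q'].
  elim/finite_set_elim: fs sqS => [_|chi {}s IH sqS]; first by exists B; split=> // q2 _ _ x.
  have [|D [sD BD DP]] := IH; first by move=> x sx; apply: sqS; right.
  case: (sqS chi); first by left.
    move=> qchi; exists D; split=> // q' q'X qq' x [->|]; first exact: qq'.
    exact: DP.
  move=> [m [phi [a [b [ab ->]]]]].
  pose D' := D `|` (range a `|` range b).
  have sD' : small K D'.
    apply: (small_setU K_large) => //.
    by apply: (small_setU K_large); exact: (small_tuple K_large).
  exists D'; split=> // [x /BD|q' q'X qq' x]; first by left.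
  (* The induction hypothesis concerns types over [D], so [q'] is restricted to [D] to treat the
     remaining formulas. *)
  have rX := same_rank_restrict Ap clsp sD sD' (subset_trans AB BD) (@subsetUl _ _ _) q'X.
  have qr : q `<=` q' `&` formula_over D.
    move=> y qy; split; first exact: qq'.
    by have [qB _ _] := Bq; apply: formula_over_sub BD (qB _ qy).
  case=> [->|sx]; last by have [] := DP _ rX qr _ sx.
  have [D'q' _ _] := q'X; have [_ q'c q'D'] := D'q'.
  have aD' i : D' (a i) by right; left; exists i.
  have bD' i : D' (b i) by right; right; exists i.
  have [h1 h2] : q' (inst a phi) <-> q' (inst b phi).
    apply: (Lascar_equiv_indist sA Ap clsp rp phi ab sD' _ _ _ q'X).
    - by move=> y Ay; left; apply: BD; apply: AB.
    - by move=> _ [i _ <-]; apply: aD'.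
    - by move=> _ [i _ <-]; apply: bD'.
  have over V (e : V -> C) (th : formula L ('I_n + V)) : (forall i, D' (e i)) ->
      formula_over D' (inst e th) by apply: formula_over_inst.
  apply: contrapT.
  have Dimp : formula_over D' (fimp (inst a phi) (inst b phi)).
    have := over _ (copair a b) (fimp (rename (copair inl (inr \o inl)) phi)
      (rename (copair inl (inr \o inr)) phi)).
    rewrite /inst /= !rename_comp.
    have -> : (fun s => match s with inl v => inl v | inr y => inr (copair a b y) end)
      \o copair inl (inr \o inl) = (fun s : 'I_n + 'I_m => match s with inl v => inl v
        | inr y => inr (a y) end) by apply/funext; case.
    have -> : (fun s => match s with inl v => inl v | inr y => inr (copair a b y) end)
      \o copair inl (inr \o inr) = (fun s : 'I_n + 'I_m => match s with inl v => inl v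
        | inr y => inr (b y) end) by apply/funext; case.
    by apply; case.
  move=> /(complete_type_neg D'q' Dimp) nimp.
  (* Either [q'] contains phi(x,a), and so phi(x,b), or it contains the negation of phi(x,a); both
     are inconsistent with the negated implication. *)
  case: (pselect (q' (inst a phi))) => qa.
    have [e [e1 e2 _]] := consistent_elim3 q'c nimp (h1 qa) qa.
    by apply: e1 => _.
  have na := (complete_type_neg D'q' (over _ _ _ aD')).2 qa.
  have [e [e1 e2 _]] := consistent_elim3 q'c nimp na na.
  by apply: e1 => /e2.
have [q' q'X qq'] := same_rank_extend clsp rp sB sD BD qX.
have [[_ q'c _] _ _] := q'X.
by have [e he] := q'c s fs (sDP q' q'X qq'); exists e.
Qed.

End Rank.

Theorem proposition2p22 (L : language) (T : set (sentence L)) (C : structure L)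
  (K : Type) (W : Type) (lt : W -> W -> Prop)
  (cls : forall n, set (set (pformula C n)))
  (R : forall n, set (pformula C n) -> option W)
  (T_complete : complete_theory T)
  (K_large : sufficiently_large L K)
  (C_monster : monster_model T K C)
  (lt_wo : well_order lt)
  (cls_class : type_class K cls)
  (R_rank : is_rank lt cls R) :
  (Lascar_splitting_rank K lt cls R -> strong_bounded_multiplicity K cls R) /\
  (bounded_multiplicity K cls R /\ has_extension K cls R ->
     Lascar_splitting_rank K lt cls R).
Proof.
have [_ C_saturated C_homogeneous] := C_monster; split=> [|[R_bounded R_extension]].
  exact: Lascar_splitting_rank_strong_bounded.
exact: (bounded_extension_Lascar_splitting_rank K_large C_saturated C_homogeneous lt_wo).
Qed.
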